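(* There exists a cyclically $6$-connected strictly critical snark of order $n$ in each of the following cases: (i) $n\equiv 0\pmod 8$ and $n\ge 320$; (ii) $n\equiv 2\pmod 8$ and $n\ge 306$; (iii) $n\equiv 4\pmod 8$ and $n\ge 324$; (iv) $n\equiv 6\pmod 8$ and $n\ge 342$.
   Context: A snark is a connected cubic graph with chromatic index $4$. A snark is critical if, for every pair of distinct adjacent vertices, the graph obtained by removing these two vertices is $3$-edge-colourable; it is bicritical if the same holds for every pair of distinct vertices; it is strictly critical if it is critical but not bicritical. A cubic graph is cyclically $k$-connected if no set of fewer than $k$ edges separates two cycles of the graph from each other. *)

(* Defs.v *)
From mathcomp Require Import all_boot.

Set Implicit Arguments.
Unset Strict Implicit.
Unset Printing Implicit Defensive.

Record sgraph := SGraph {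
  vertex :> finType;
  adj : rel vertex;
  adj_sym : symmetric adj;
  adj_irrefl : irreflexive adj
}.

Section SimpleGraph.
Variable G : sgraph.
Implicit Types (A : {set G}) (S : {set {set G}}) (k : nat).

Definition edges : {set {set G}} :=
  [set e : {set G} | [exists x, exists y, adj x y && (e == [set x; y])]].

Definition cubic : Prop := forall x : G, #|[set y | adj x y]| = 3.

Definition connected : Prop :=
  0 < #|G| /\ forall x y : G, connect (@adj G) x y.

(* Colours are assigned to actual edges only, so that an edgeless graph is
   0-edge-colourable. *)
Definition proper_edge_colouring k
    (c : {ffun {e : {set G} | e \in edges} -> 'I_k}) : bool :=
  [forall e, forall f,
     (e != f) && (val e :&: val f != set0) ==> (c e != c f)].

Definition edge_colourable k : bool :=
  [exists c : {ffun {e : {set G} | e \in edges} -> 'I_k},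
     proper_edge_colouring c].

Lemma edge_colourable_ex : exists k, edge_colourable k.
Proof.
exists #|{: {e : {set G} | e \in edges}}|; apply/existsP.
exists [ffun e => enum_rank e]; apply/forallP => e; apply/forallP => f.
by apply/implyP => /andP[nef _]; rewrite !ffunE (inj_eq enum_rank_inj).
Qed.

Definition chromatic_index : nat := ex_minn edge_colourable_ex.

Definition del_adj A : rel {x : G | x \notin A} :=
  fun x y => adj (val x) (val y).

Lemma del_adj_sym A : symmetric (@del_adj A).
Proof. by move=> x y; apply: adj_sym. Qed.

Lemma del_adj_irrefl A : irreflexive (@del_adj A).
Proof. by move=> x; apply: adj_irrefl. Qed.

(* The graph obtained by removing the vertices in A (and their edges). *)
Definition del_vertices A : sgraph :=
  SGraph (@del_adj_sym A) (@del_adj_irrefl A).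

Definition graph_cycle (c : seq G) : Prop := 2 < size c /\ ucycle (@adj G) c.

Definition del_edges_adj S : rel G :=
  fun x y => adj x y && ([set x; y] \notin S).

Definition separates S (c d : seq G) : Prop :=
  forall x y, x \in c -> y \in d -> ~~ connect (del_edges_adj S) x y.

Definition cyclically_connected k : Prop :=
  forall S, S \subset edges -> #|S| < k ->
  ~ exists c d : seq G, [/\ graph_cycle c, graph_cycle d & separates S c d].

Definition snark : Prop := [/\ connected, cubic & chromatic_index = 4].

End SimpleGraph.

Section Criticality.
Variable G : sgraph.

Definition critical : Prop :=
  forall u v : G, u != v -> adj u v ->
  edge_colourable (del_vertices [set u; v]) 3.

Definition bicritical : Prop :=
  forall u v : G, u != v -> edge_colourable (del_vertices [set u; v]) 3.

Definition strictly_critical : Prop := critical /\ ~ bicritical.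

End Criticality.

(* Main.v *)
(* The graphs are superpositions of the Petersen graph.  Read the three colours as
   the nonzero elements of the Klein group.  Deleting two nonadjacent vertices of a
   snark leaves a pole with two triples of dangling edges, and in every 3-edge-colouring
   of the pole both triples have the same nonzero sum: were the sum zero, the two
   vertices could be put back.  Replace by such poles the eight edges of the theta
   subgraph of the Petersen graph formed by a hexagon h0 ... h5 and a path h0 l0 h3.
   Replace h0 by three isolated vertices, and every other vertex of the theta by itself
   together with edges that bypass it.  A 3-edge-colouring of the result, even without
   the three vertices that replace h0, would induce one of the Petersen graph.  So any
   two of these vertices show that the graph is not bicritical.

   The poles come from the flower snark J_5 (18 vertices), from the double-star snark
   (28 vertices, used j times) and, once, from J_(5+2k), which gives order
   156 + 10 j + 8 k; here j = 0, 1, 2, 3 covers all even residues modulo 8.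
   Criticality and cyclic connectivity are proved for all k at once: for a colouring,
   the state between two pairs of blocks of J_(5+2k) can be repeated by a further pair
   of blocks, and the profiles of small edge cuts become stable along the chain. *)
Require Import Defs.
From mathcomp Require Import all_boot.

Set Implicit Arguments.
Unset Strict Implicit.
Unset Printing Implicit Defensive.

(** * Cubic graphs from multigraphs with good edge expansion *)

(** Why deleting the replacement of h0 gives no freedom: the three Klein elements at a properly
    coloured vertex add up to zero, so the colours on all nine free ends add up to zero. The three
    triple sums at h0 are nonzero and have sum zero, hence are distinct, and the induced colouring
    of the Petersen graph is proper at h0 as well. At the other vertices of the theta the bypass
    edges cancel. The obstacle is that statements about all colourings and all cuts of graphs with
    hundreds of edges, for every length of the chain, have to be settled by computation. Each graph
    is therefore a program that adds one vertex at a time and remembers only a short list of pending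
    edges. Such statements become reachability questions about the states of this list, and the
    chain is covered by a set of states closed under one more pair of blocks. Cyclic connectivity is
    replaced by edge expansion, a condition on vertex sets that can be computed along the same list;
    it also makes the multigraph simple and triangle-free. *)

Section Multigraph.
Variables (n m : nat) (s d : 'I_m -> 'I_n).
Implicit Types (x y z : 'I_n) (e f : 'I_m) (A : {set 'I_n}).

Definition incident x : {set 'I_m} := [set e | (s e == x) || (d e == x)].
Definition boundary A : {set 'I_m} := [set e | (s e \in A) != (d e \in A)].
Definition joins e x y := (s e == x) && (d e == y) || (s e == y) && (d e == x).
Definition mg_adj x y := (x != y) && [exists e, joins e x y].

Lemma joinsC e x y : joins e x y = joins e y x.
Proof. exact: orbC. Qed.

Lemma mg_adj_sym : symmetric mg_adj.
Proof.
move=> x y; rewrite /mg_adj eq_sym; congr andb.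
by apply: eq_existsb => e; rewrite joinsC.
Qed.

Lemma mg_adj_irrefl : irreflexive mg_adj.
Proof. by move=> x; rewrite /mg_adj eqxx. Qed.

Definition mgraph : sgraph := SGraph mg_adj_sym mg_adj_irrefl.

Hypothesis deg3 : forall x, #|[set e | s e == x]| + #|[set e | d e == x]| = 3.
Hypothesis n_gt7 : 7 < n.
(** A set of k vertices that induces a tree in a cubic graph has 3k - 2(k - 1) = k + 2 boundary
    edges. The bound thus says that at most three vertices span no cycle, and that a cut with at
    least four vertices on both sides has at least six edges. *)
Hypothesis expand : forall A, 0 < #|A| -> 0 < #|~: A| ->
  minn (minn #|A| #|~: A|) 4 + 2 <= #|boundary A|.

Definition inner A : {set 'I_m} := [set e | (s e \in A) && (d e \in A)].

Lemma handshake A : 3 * #|A| = #|boundary A| + 2 * #|inner A|.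
Proof.
have fib (g : 'I_m -> 'I_n) : \sum_(x in A) #|[set e | g e == x]| = #|[set e | g e \in A]|.
  rewrite -sum1_card (partition_big g (mem A)) /=; last by move=> e; rewrite inE.
  apply: eq_bigr => x Ax; rewrite -sum1_card; apply: eq_bigl => e.
  by rewrite !inE; case: eqP => [->|]; rewrite ?andbF // Ax.
have -> : 3 * #|A| = \sum_(x in A) (#|[set e | s e == x]| + #|[set e | d e == x]|).
  by rewrite mulnC -sum_nat_const; apply: eq_bigr => x _; rewrite deg3.
rewrite big_split /= !fib -cardsUI mulSn mul1n addnA.
have <- : [set e | s e \in A] :&: [set e | d e \in A] = inner A.
  by apply/setP=> e; rewrite !inE.
congr (_ + _); set U := _ :|: _; set I := _ :&: _.
have IU : I \subset U by apply/subsetP=> e; rewrite !inE => /andP[->].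
rewrite -(cardsID I U) (setIidPr IU) addnC; congr (#|pred_of_set _| + _).
by apply/setP=> e; rewrite !inE; case: (s e \in A); case: (d e \in A).
Qed.

Lemma card_setC_ge A k : #|A| <= k -> n - k <= #|~: A|.
Proof. by move=> Ak; rewrite cardsCs setCK card_ord leq_sub2l. Qed.

(** By [handshake], 3k is the boundary, at least k + 2, plus twice the number of inner edges. The
    cases k = 1, 2, 3 exclude loops, parallel edges and triangles. *)
Lemma inner_small A k : 0 < #|A| -> #|A| = k -> k <= 3 -> #|inner A| < k.
Proof.
move=> A0 Ak k3; have := handshake A; rewrite Ak => hs.
have hC : 4 <= #|~: A|.
  apply: leq_trans (card_setC_ge (k := 3) _); last by rewrite Ak.
  by rewrite leq_subRL ?(leq_trans _ n_gt7).
have := expand A0 (leq_trans _ hC); rewrite Ak => /(_ isT).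
have -> : minn (minn k #|~: A|) 4 = k.
  by rewrite (minn_idPl (leq_trans k3 (ltnW hC))) (minn_idPl (leq_trans k3 _)).
move=> bd; rewrite ltnNge; apply/negP=> kI.
have : k + 2 + 2 * k <= 3 * k by rewrite hs leq_add ?leq_mul2l.
by rewrite addnAC -{1}[k]mul1n -mulnDl -[X in _ <= X]addn0 leq_add2l.
Qed.

Lemma s_neq_d e : s e != d e.
Proof.
apply/negP=> /eqP sd.
have := @inner_small [set s e] 1; rewrite cards1 => /(_ isT erefl isT).
rewrite ltnS leqn0 cards_eq0 => /eqP/setP/(_ e).
by rewrite !inE -sd eqxx.
Qed.

Lemma joins_ends e : joins e (s e) (d e).
Proof. by rewrite /joins !eqxx. Qed.

Lemma joins_inj e f x y : joins e x y -> joins f x y -> e = f.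
Proof.
move=> je jf; apply/eqP/negPn/negP=> ef.
have xy : x != y.
  by case/orP: je (s_neq_d e) => /andP[/eqP-> /eqP->] //; rewrite eq_sym.
have := @inner_small [set x; y] 2; rewrite cards2 xy => /(_ isT erefl isT).
rewrite ltnNge => /negP; apply.
have <- : #|[set e; f]| = 2 by rewrite cards2 ef.
apply: subset_leq_card; apply/subsetP=> g; rewrite !inE.
by case/orP=> /eqP->; [case/orP: je | case/orP: jf] => /andP[/eqP-> /eqP->]; rewrite !eqxx ?orbT.
Qed.

Lemma mg_adjP x y : reflect (exists e, joins e x y) (mg_adj x y).
Proof.
apply: (iffP idP) => [/andP[_ /existsP]//|[e je]].
apply/andP; split; last by apply/existsP; exists e.
by case/orP: je (s_neq_d e) => /andP[/eqP-> /eqP->] //; rewrite eq_sym.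
Qed.

Lemma mg_triangle_free x y z : mg_adj x y -> mg_adj y z -> mg_adj z x -> False.
Proof.
move=> xy yz zx; have := (xy, yz, zx).
case=> -[/andP[nxy _] /andP[nyz _] /andP[nzx _]].
case/mg_adjP: xy => e je; case/mg_adjP: yz => f jf; case/mg_adjP: zx => g jg.
have c3 : #|[set x; y; z]| = 3.
  by rewrite setUC cardsU1 !inE negb_or nzx (eq_sym z) nyz cards2 nxy.
have := @inner_small [set x; y; z] 3; rewrite c3 => /(_ isT erefl isT).
rewrite ltnNge => /negP; apply.
have <- : #|[set e; f; g]| = 3.
  have dist a b u v w t : joins a u v -> joins b w t -> u != w -> u != t -> a != b.
    move=> ja jb uw ut; apply/eqP=> ab; move: jb; rewrite -ab.
    case/orP: ja => /andP[/eqP sa /eqP da].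
      by rewrite /joins sa (negPf uw) (negPf ut).
    by rewrite /joins da (negPf uw) (negPf ut) !andbF.
  rewrite setUC cardsU1 !inE negb_or cards2.
  have -> : e != f by apply: dist je jf nxy _; rewrite eq_sym.
  have -> : g != e by rewrite eq_sym; apply: (dist _ _ y x z x) => //; rewrite 1?joinsC // eq_sym.
  by have -> : g != f by apply: (dist _ _ x z y z) => //; rewrite 1?joinsC // eq_sym.
apply: subset_leq_card; apply/subsetP=> h; rewrite !inE.
by case/orP=> [/orP[]|] /eqP->; [case/orP: je | case/orP: jf | case/orP: jg] =>
  /andP[/eqP-> /eqP->]; rewrite !eqxx ?orbT.
Qed.

Lemma card_incident x : #|incident x| = 3.
Proof.
rewrite -(deg3 x) -cardsUI.
have -> : [set e | s e == x] :&: [set e | d e == x] = set0.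
  apply/setP=> e; rewrite !inE; apply/negP=> /andP[/eqP se /eqP de].
  by have := s_neq_d e; rewrite se de eqxx.
by rewrite cards0 addn0; apply: eq_card => e; rewrite !inE.
Qed.

Lemma mg_cubic : cubic mgraph.
Proof.
move=> x; rewrite -(card_incident x).
(* The far end of an edge at [x]; as there are no parallel edges, it is injective on the incident
   edges, so neighbours can be counted by edges. *)
pose other e := if s e == x then d e else s e.
have jo e : e \in incident x -> joins e x (other e).
  rewrite inE /other /joins; case: eqP => [->|_]; first by rewrite !eqxx.
  by move=> /= /eqP->; rewrite !eqxx ?orbT.
rewrite -(@card_in_imset _ _ other).
  apply: eq_card => y; rewrite inE; apply/mg_adjP/imsetP.
    case=> e je; exists e; first by case/orP: je => /andP[se de]; rewrite inE ?se ?de ?orbT.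
    rewrite /other; case/orP: je => /andP[/eqP se /eqP de]; first by rewrite se eqxx.
    by case: eqP => [sx|//]; move: (s_neq_d e); rewrite sx de eqxx.
  by case=> e xe ->; exists e; apply: jo.
move=> e f xe xf ef; apply: (@joins_inj e f x (other e)); first exact: jo.
by rewrite ef; apply: jo.
Qed.

Lemma mg_connected : connected mgraph.
Proof.
split=> [|x y]; first by rewrite card_ord (leq_trans _ n_gt7).
apply/negPn/negP=> nxy; pose A := [set z | connect (@adj mgraph) x z].
have : 0 < #|boundary A|.
  apply: leq_trans (expand (A := A) _ _); first by rewrite addn2.
    by apply/card_gt0P; exists x; rewrite inE connect0.
  by apply/card_gt0P; exists y; rewrite !inE.
case/card_gt0P=> e; rewrite !inE.
have sd : adj (s e : mgraph) (d e) by apply/mg_adjP; exists e; apply: joins_ends.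
have ds : adj (d e : mgraph) (s e) by rewrite adj_sym.
by move=> /negP[]; apply/eqP; apply/idP/idP=> c; apply: connect_trans c (connect1 _).
Qed.

(** The set [A] reachable from the first cycle without [S] has its boundary inside [S]. Both sides
    contain a cycle, of length at least four for lack of triangles, so the expansion bound asks for
    six edges. *)
Lemma mg_cyclically_connected : cyclically_connected mgraph 6.
Proof.
move=> S SE S6 [c [c' [[c2 /andP[cc cu]] [c2' /andP[cc' cu']] sep]]].
pose A := [set z | [exists x in c, connect (del_edges_adj S) x z]].
have cA : {subset c <= A}.
  by move=> x xc; rewrite inE; apply/existsP; exists x; rewrite xc connect0.
have c'A : {subset c' <= ~: A}.
  move=> y yc; rewrite !inE; apply/existsP=> -[x /andP[xc]].
  by apply/negP; apply: sep.
have szA (t : seq 'I_n) (B : {set 'I_n}) : uniq t -> {subset t <= B} -> size t <= #|B|.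
  by move=> ut tB; rewrite -(card_uniqP ut); apply/subset_leq_card/subsetP.
have A3 : 2 < #|A| := leq_trans c2 (szA _ _ cu cA).
have A3' : 2 < #|~: A| := leq_trans c2' (szA _ _ cu' c'A).
have bS : #|boundary A| <= #|S|.
  (* [S] consists of vertex pairs; distinct edges of the multigraph have distinct end pairs, so
     counting end pairs loses nothing. *)
  rewrite -(@card_in_imset _ _ (fun e => [set s e; d e])).
    apply: subset_leq_card; apply/subsetP=> _ /imsetP[e be ->].
    apply/negPn/negP=> eS; move: be; rewrite !inE => /negP[].
    have step x y : joins e x y -> del_edges_adj S (x : mgraph) y.
      move=> j; apply/andP; split; first by apply/mg_adjP; exists e.
      by case/orP: j eS => /andP[/eqP-> /eqP->] //; rewrite setUC.
    have st := step _ _ (joins_ends e).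
    have ts : del_edges_adj S (d e : mgraph) (s e).
      by apply: step; rewrite /joins !eqxx orbT.
    by apply/eqP; apply/idP/idP=> /existsP[x /andP[xc xe]]; apply/existsP; exists x;
      rewrite xc; apply: connect_trans xe (connect1 _).
  move=> e f _ _ ef; apply: (joins_inj (joins_ends e)).
  have: s f \in [set s e; d e] by rewrite ef !inE eqxx.
  have: d f \in [set s e; d e] by rewrite ef !inE eqxx orbT.
  rewrite !inE => /orP[]/eqP df /orP[]/eqP sf; move: (s_neq_d f);
  by rewrite /joins ?df ?sf ?eqxx ?orbT.
have small (t : seq mgraph) (B : {set 'I_n}) : 2 < size t -> ucycle (@adj mgraph) t ->
    {subset t <= B} -> 3 < #|B|.
  move=> t2 /andP[tc tu] tB; apply: leq_trans (szA _ _ tu tB).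
  case: t t2 tc tu tB => [|x [|y [|z [|u t]]]] //= _ /and4P[xy yz zx _].
  by case: (mg_triangle_free xy yz zx).
have A4 : 3 < #|A| by apply: (small c) => //; apply/andP.
have A4' : 3 < #|~: A| by apply: (small c') => //; apply/andP.
have := expand (A := A) (leq_trans _ A4) (leq_trans _ A4').
move=> /(_ isT isT); rewrite (minn_idPr _); last by rewrite leq_min A4 A4'.
by rewrite leqNgt (leq_ltn_trans bS).
Qed.

(** * Colourings of a subgraph in terms of the edges of the multigraph *)

Section Colouring.
Variables (H : sgraph) (h : H -> 'I_n).
Hypothesis h_inj : injective h.

(** Each edge of [H] takes the colour of a multigraph edge with the same ends. Properness is asked
    only at vertices in the image of [h], so [col] may be arbitrary at deleted vertices. *)
Lemma edge_colourable_of k (col : 'I_m -> 'I_k) :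
    (forall x y : H, adj x y -> mg_adj (h x) (h y)) ->
    (forall x : H, {in incident (h x) &, injective col}) ->
  edge_colourable H k.
Proof.
move=> hadj col_inj.
have rep (E : {E : {set H} | E \in edges H}) : exists e, [set s e; d e] == h @: val E.
  case: E => E /= EH; move: (EH); rewrite inE => /existsP[x /existsP[y /andP[/hadj/mg_adjP[e je] /eqP->]]].
  exists e; rewrite imsetU1 imset_set1.
  by case/orP: je => /andP[/eqP-> /eqP->] //; rewrite setUC.
apply/existsP; exists [ffun E => col (xchoose (rep E))].
apply/forallP=> E; apply/forallP=> F; apply/implyP=> /andP[neEF /set0Pn[x]].
rewrite inE !ffunE => /andP[xE xF]; apply: contra neEF => /eqP eq_col.
have inc (G : {E : {set H} | E \in edges H}) (xG : x \in val G) : xchoose (rep G) \in incident (h x).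
  rewrite inE ![_ == h x]eq_sym -in_set2 (eqP (xchooseP (rep G))).
  exact: imset_f.
rewrite -val_eqE -(inj_eq (imset_inj h_inj)).
by rewrite -(eqP (xchooseP (rep E))) -(eqP (xchooseP (rep F))) (col_inj x _ _ _ _ eq_col) ?inc.
Qed.

(* Edges of the multigraph with exactly one end in the image of [h] are given
   the colours left unused at that end. *)
Lemma colouring_extends :
    (forall x y : H, mg_adj (h x) (h y) -> adj x y) -> edge_colourable H 3 ->
  exists col : 'I_m -> 'I_3, forall x : H, {in incident (h x) &, injective col}.
Proof.
move=> hadj /existsP[c /forallP cP].
pose im e := (s e \in codom h) && (d e \in codom h).
pose colE e := if [pick E : {E : {set H} | E \in edges H} | [set s e; d e] == h @: val E]
  is Some E then c E else ord0.
have colE_inj (x : H) : {in [set e in incident (h x) | im e] &, injective colE}.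
  have rep e : e \in [set e in incident (h x) | im e] ->
      exists2 E, colE e = c E & [set s e; d e] = h @: val E /\ x \in val E.
    rewrite !inE => /andP[xe /andP[/codomP[y sy] /codomP[z dz]]].
    have yz : adj y z.
      by apply: hadj; rewrite -sy -dz; apply/mg_adjP; exists e; apply: joins_ends.
    have yzE : [set y; z] \in edges H.
      by rewrite inE; apply/existsP; exists y; apply/existsP; exists z; rewrite yz eqxx.
    rewrite /colE; case: pickP => [E /eqP eE | /(_ (exist (fun E : {set H} => E \in edges H) _ yzE))].
      exists E => //; split=> //.
      by rewrite -(mem_imset _ _ h_inj) -eE !inE ![h x == _]eq_sym.
    by rewrite /= sy dz imsetU1 imset_set1 eqxx.
  move=> e f /rep[E -> [eE xE]] /rep[F -> [fF xF]] eq_c.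
  have EF : E = F.
    apply/eqP/negPn/negP=> nEF; have /forallP/(_ F)/implyP := cP E.
    rewrite nEF eq_c eqxx => /(_ _)/negP[] //.
    by apply/set0Pn; exists x; rewrite inE xE.
  apply: (joins_inj (joins_ends e)); move: fF; rewrite -EF -eE => ef.
  have: s f \in [set s e; d e] by rewrite -ef !inE eqxx.
  have: d f \in [set s e; d e] by rewrite -ef !inE eqxx orbT.
  rewrite !inE => /orP[]/eqP df /orP[]/eqP sf; move: (s_neq_d f);
  by rewrite /joins ?df ?sf ?eqxx ?orbT.
pose inn (x : 'I_n) := [set e in incident x | im e].
pose dang (x : 'I_n) := [set e in incident x | ~~ im e].
pose unused x := enum (~: (colE @: inn x)).
pose hend e := if s e \in codom h then s e else d e.
exists (fun e => if im e then colE e else nth ord0 (unused (hend e)) (index e (enum (dang (hend e))))).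
move=> x.
have sz : size (unused (h x)) = #|dang (h x)|.
  rewrite -cardE cardsCs setCK card_ord (card_in_imset (colE_inj x)).
  rewrite -(card_incident (h x)) -(cardsID [set e | im e] (incident (h x))) addnC.
  have -> : incident (h x) :&: [set e | im e] = inn (h x) by apply/setP=> e; rewrite !inE.
  by rewrite addnK; apply: eq_card => e; rewrite !inE andbC.
have hendE e : e \in incident (h x) -> ~~ im e -> hend e = h x.
  rewrite inE /hend /im => /orP[]/eqP-> ; first by rewrite codom_f.
  by rewrite codom_f andbT => /negPf->.
have dE e : e \in incident (h x) -> ~~ im e -> e \in dang (h x).
  by move=> xe ne; rewrite inE xe.
have lt e : e \in incident (h x) -> ~~ im e -> index e (enum (dang (h x))) < size (unused (h x)).
  by move=> xe ne; rewrite sz cardE index_mem mem_enum dE.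
have mixed e f : e \in incident (h x) -> f \in incident (h x) -> im e -> ~~ im f ->
    colE e != nth ord0 (unused (h x)) (index f (enum (dang (h x)))).
  move=> xe xf me nf; apply/eqP=> eq_c; have := mem_nth ord0 (lt f xf nf).
  rewrite -eq_c mem_enum inE => /negP[]; apply: imset_f.
  by rewrite inE xe.
move=> e f xe xf.
case: ifP => me; case: ifP => mf.
- by apply: (colE_inj x); rewrite inE ?xe ?xf ?me ?mf.
- by rewrite (hendE f) ?mf // => /eqP; rewrite (negPf (mixed _ _ xe xf me (negbT mf))).
- by rewrite (hendE e) ?me // => /eqP; rewrite eq_sym (negPf (mixed _ _ xf xe mf (negbT me))).
rewrite !hendE ?me ?mf // => /eqP; rewrite nth_uniq ?lt ?me ?mf ?enum_uniq // => /eqP.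
by apply: index_inj; rewrite ?mem_enum ?dE ?me ?mf.
Qed.

End Colouring.

(** The second hypothesis serves twice: a 3-edge-colouring of the whole graph, or of the graph
    without [u] and [v], would extend to a [col] that is proper away from [u] and [v]. It thus gives
    both the lower bound on the chromatic index and the failure of bicriticality. *)
Lemma mg_strictly_critical (u v : 'I_n) : u != v ->
    ~ (exists col : 'I_m -> 'I_3,
         forall x, x \notin [set u; v] -> {in incident x &, injective col}) ->
    (forall e, exists col : 'I_m -> 'I_3,
         forall x, x != s e -> x != d e -> {in incident x &, injective col}) ->
    (exists col : 'I_m -> 'I_4, forall x, {in incident x &, injective col}) ->
  snark mgraph /\ strictly_critical mgraph.
Proof.
move=> uv uncol crit [col4 col4P].
have widen_col k k' : k <= k' -> edge_colourable mgraph k -> edge_colourable mgraph k'.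
  move=> kk' /existsP[c /forallP cP]; apply/existsP; exists [ffun E => widen_ord kk' (c E)].
  apply/forallP=> E; apply/forallP=> F; rewrite !ffunE.
  by have /forallP/(_ F)/implyP cEF := cP E; apply/implyP.
split; last split.
- split; [exact: mg_connected | exact: mg_cubic |].
  rewrite /chromatic_index; case: ex_minnP => k ck kmin; apply/eqP; rewrite eqn_leq.
  rewrite kmin /=; last exact: (@edge_colourable_of mgraph id (@inj_id _) _ col4).
  rewrite ltnNge; apply/negP=> k3; apply: uncol.
  have [|col colP] := @colouring_extends mgraph id (@inj_id _) (fun _ _ => id).
    exact: widen_col k3 ck.
  by exists col => x _; apply: colP.
- move=> x y _ /mg_adjP[e je]; have [col colP] := crit e.
  apply: (@edge_colourable_of (del_vertices (G := mgraph) [set x; y]) val val_inj _ col) => //.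
  case=> z /=; rewrite !inE negb_or => /andP[zx zy].
  by case/orP: je => /andP[/eqP se /eqP de]; apply: colP; rewrite ?se ?de.
- move=> bic; apply: uncol.
  have [col colP] := @colouring_extends (del_vertices (G := mgraph) [set u; v])
    val val_inj (fun _ _ => id) (bic u v uv).
  exists col => x xuv; exact: (colP (exist (fun x : mgraph => x \notin [set u; v]) x xuv)).
Qed.

End Multigraph.

(** * Words and their colourings *)

(* A word builds a cubic graph vertex by vertex, together with the list of pending
   edges: [V j] adds a vertex that uses the first [j] pending edges and starts
   [3 - j] new ones, placed in front; [P i] pulls the pending edge of index [i] to
   the front. *)
Inductive letter := V of nat | P of nat.
Notation word := (seq letter).
Implicit Types (w : word).

(** An index out of range leaves the list unchanged, so [pull] is always a permutation and commutes
    with [map] without side conditions. *)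
Definition pull T i (f : seq T) := if drop i f is x :: f' then x :: take i f ++ f' else f.

Lemma map_pull T S (g : T -> S) i f : map g (pull i f) = pull i (map g f).
Proof. by rewrite /pull -map_drop -map_take; case: (drop i f) => //= x t; rewrite map_cat. Qed.

Lemma pull_cat T i (f t : seq T) : i < size f -> pull i (f ++ t) = pull i f ++ t.
Proof.
move=> lt; rewrite /pull drop_cat take_cat lt.
by case: (drop i f) (size_drop i f) => [|x f'] /= h; rewrite ?catA //; move: lt; rewrite -subn_gt0 -h.
Qed.

Lemma dropl_cat T i (f t : seq T) : i <= size f -> drop i (f ++ t) = drop i f ++ t.
Proof.
rewrite drop_cat leq_eqVlt => /orP[/eqP->|->//].
by rewrite ltnn subnn drop0 drop_size.
Qed.

Lemma perm_pull (T : eqType) i (f : seq T) : perm_eq (pull i f) f.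
Proof.
rewrite /pull; have := cat_take_drop i f; case: (drop i f) => [|x t] // Ef.
by rewrite -[X in perm_eq _ X]Ef -(cat1s x t) -(cat1s x (_ ++ t)) perm_catCA.
Qed.

Fixpoint nids w := if w is L :: w then (if L is V j then 3 - j else 0) + nids w else 0.
Fixpoint nverts w := if w is L :: w then (if L is V _ then 1 else 0) + nverts w else 0.

Fixpoint arity w a : option nat :=
  match w with
  | [::] => Some a
  | V j :: w => if (j <= a) && (j <= 3) then arity w (3 - j + (a - j)) else None
  | P i :: w => if i < a then arity w a else None
  end.

(* For each vertex, the edges it ends and the edges it starts; edges are numbered from
   [c] on in the order in which they are started. *)
Fixpoint inc w (f : seq nat) c : seq (seq nat * seq nat) :=
  match w with
  | [::] => [::]
  | V j :: w => (take j f, iota c (3 - j)) :: inc w (iota c (3 - j) ++ drop j f) (c + (3 - j))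
  | P i :: w => inc w (pull i f) c
  end.

Fixpoint out w (f : seq nat) c : seq nat :=
  match w with
  | [::] => f
  | V j :: w => out w (iota c (3 - j) ++ drop j f) (c + (3 - j))
  | P i :: w => out w (pull i f) c
  end.

(* [f] holds the colours of the pending edges and [cs] those of the edges to be started. *)
Fixpoint exec (ok : seq nat -> bool) w (f cs : seq nat) : option (seq nat) :=
  match w with
  | [::] => Some f
  | V j :: w => let o := take (3 - j) cs in
      if ok (take j f ++ o) then exec ok w (o ++ drop j f) (drop (3 - j) cs) else None
  | P i :: w => exec ok w (pull i f) cs
  end.

(** Running a word on colours is the image under [col] of running it on edge numbers. This is the
    bridge between the computed [exec] and the incidences of the graph. *)
Lemma exec_map ok (col : nat -> nat) w f c :
  exec ok w (map col f) (map col (iota c (nids w))) =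
  if all (fun I => ok (map col (I.1 ++ I.2))) (inc w f c) then Some (map col (out w f c)) else None.
Proof.
elim: w f c => [|[j|i] w IHw] f c //=; last by rewrite add0n -map_pull IHw.
rewrite -!map_take -!map_drop take_iota drop_iota addKn (minn_idPl (leq_addr _ _)).
by rewrite -!map_cat IHw; case: (ok _).
Qed.

Lemma exec_cat ok w1 w2 f cs1 cs2 : size cs1 = nids w1 ->
  exec ok (w1 ++ w2) f (cs1 ++ cs2) = obind (fun g => exec ok w2 g cs2) (exec ok w1 f cs1).
Proof.
elim: w1 f cs1 => [|[j|i] w IHw] f cs1 /= sz; first by case: cs1 sz.
  have le : 3 - j <= size cs1 by rewrite sz leq_addr.
  rewrite takel_cat // dropl_cat // IHw; first by case: (ok _).
  by rewrite size_drop sz addKn.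
by rewrite IHw.
Qed.

Lemma size_pull T i (f : seq T) : size (pull i f) = size f.
Proof.
rewrite /pull; have := cat_take_drop i f; case: (drop i f) => [|x t] // Ef.
by rewrite -[in RHS]Ef /= !size_cat addnS.
Qed.

(** Pending edges beyond the arity are never touched, so the behaviour of a piece can be tabulated
    in isolation and used with any list behind it. *)
Lemma exec_frame ok w f t cs a : arity w (size f) = Some a -> nids w <= size cs ->
  exec ok w (f ++ t) cs = omap (cat^~ t) (exec ok w f cs).
Proof.
elim: w f cs => [|[j|i] w IHw] f cs //=; last first.
  by case: ifP => // lt ar sz; rewrite pull_cat // IHw // size_pull.
case: ifP => // /andP[jf j3] ar sz; rewrite takel_cat //.
rewrite dropl_cat //; case: (ok _) => //; rewrite catA IHw //; last by rewrite size_drop leq_subRL ?(leq_trans _ sz) ?leq_addr.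
rewrite size_cat size_drop size_takel //; exact: leq_trans (leq_addr _ _) sz.
Qed.

Lemma inc_cat w1 w2 f c :
  inc (w1 ++ w2) f c = inc w1 f c ++ inc w2 (out w1 f c) (c + nids w1).
Proof.
elim: w1 f c => [|[j|i] w IHw] f c /=; first by rewrite addn0.
  by rewrite IHw addnA.
by rewrite IHw.
Qed.

Lemma nids_cat w1 w2 : nids (w1 ++ w2) = nids w1 + nids w2.
Proof. by elim: w1 => //= L w ->; rewrite addnA. Qed.

Lemma nverts_cat w1 w2 : nverts (w1 ++ w2) = nverts w1 + nverts w2.
Proof. by elim: w1 => //= L w ->; rewrite addnA. Qed.

Lemma arity_cat w1 w2 a : arity (w1 ++ w2) a = obind (arity w2) (arity w1 a).
Proof. by elim: w1 a => [|[j|i] w IHw] a //=; case: ifP. Qed.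

Lemma size_inc w f c : size (inc w f c) = nverts w.
Proof. by elim: w f c => [|[j|i] w IHw] f c //=; rewrite IHw. Qed.

Lemma inc_pushed w f c : flatten (map snd (inc w f c)) = iota c (nids w).
Proof.
by elim: w f c => [|[j|i] w IHw] f c //=; rewrite IHw // iotaD.
Qed.

(** Conservation of edges: whatever was pending or is started is either ended at some vertex or
    still pending. For a closed word every edge therefore ends exactly once. *)
Lemma inc_consumed w f c :
  perm_eq (flatten (map fst (inc w f c)) ++ out w f c) (f ++ iota c (nids w)).
Proof.
elim: w f c => [|[j|i] w IHw] f c /=; first by rewrite cats0.
  rewrite -catA (perm_trans (perm_cat (perm_refl _) (IHw _ _))) //.
  rewrite iotaD -[f in X in perm_eq _ X](cat_take_drop j f) -!catA perm_cat2l.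
  by rewrite perm_catCA.
by apply: perm_trans (IHw _ _) _; rewrite perm_cat2r perm_pull.
Qed.

Lemma inc_cubic w f c a : arity w (size f) = Some a ->
  all (fun I => size I.1 + size I.2 == 3) (inc w f c).
Proof.
elim: w f c => [|[j|i] w IHw] f c //=; last first.
  by case: ifP => // _ ar; apply: IHw; rewrite size_pull.
case: ifP => // /andP[jf j3] ar; rewrite size_takel // size_iota subnKC //=.
by apply: IHw; rewrite size_cat size_iota size_drop.
Qed.

Lemma inc_uniq w f c : uniq f -> all (fun i => i < c) f ->
  all (fun I => uniq (I.1 ++ I.2)) (inc w f c).
Proof.
elim: w f c => [|[j|i] w IHw] f c //= uf fc; last first.
  by apply: IHw; rewrite ?(perm_uniq (perm_pull i f)) // (perm_all _ (perm_pull i f)).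
have fresh (l : seq nat) k : {subset l <= f} -> ~~ has (mem l) (iota c k).
  move=> lf; apply/hasPn=> i; rewrite mem_iota => /andP[ci _].
  by apply/negP=> /lf/(allP fc); rewrite ltnNge ci.
rewrite cat_uniq take_uniq // iota_uniq andbT fresh //=; last exact: mem_take.
apply: IHw; first by rewrite cat_uniq iota_uniq drop_uniq // andbT has_sym fresh //; apply: mem_drop.
rewrite all_cat; apply/andP; split; apply/allP=> i.
  by rewrite mem_iota => /andP[].
by move/mem_drop/(allP fc)/leq_trans; apply; rewrite leq_addr.
Qed.

Lemma size_out w f c a : arity w (size f) = Some a -> size (out w f c) = a.
Proof.
elim: w f c => [|[j|i] w IHw] f c /=; first by case.
  by case: ifP => // _ ar; apply: IHw; rewrite size_cat size_iota size_drop.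
by case: ifP => // _ ar; apply: IHw; rewrite size_pull.
Qed.

Lemma find_flatten (T : eqType) (L : seq (seq T)) e x : uniq (flatten L) -> x < size L ->
  (e \in nth [::] L x) = (e \in flatten L) && (find (fun l => e \in l) L == x).
Proof.
elim: L x => // l L IHL [|x] /=; rewrite cat_uniq mem_cat => /and3P[_ dis uL] ltx.
  by case: (e \in l) => //=; rewrite andbF.
rewrite ltnS in ltx; case el: (e \in l) => //=; last by rewrite IHL.
apply: contraNF dis => ex; apply/hasP; exists e => //.
by apply/flattenP; exists (nth [::] L x) => //; apply: mem_nth.
Qed.

Lemma uniq_in_flatten (T : eqType) (L : seq (seq T)) l : uniq (flatten L) -> l \in L -> uniq l.
Proof.
elim: L => // l' L IHL /=; rewrite cat_uniq inE => /and3P[ul' _ uL] /orP[/eqP->|] //.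
exact: IHL.
Qed.

Lemma map_uniq_inj (T S : eqType) (g : T -> S) l : uniq (map g l) -> {in l &, injective g}.
Proof.
elim: l => //= a l IHl /andP[na ul] x y; rewrite !inE.
case/orP=> [/eqP->|xl] /orP[/eqP->|yl] // gxy; last exact: IHl.
  by rewrite gxy map_f in na.
by rewrite -gxy map_f in na.
Qed.

(** Nested conditionals in place of [uniq] or [&&]: under call-by-value evaluation both arguments of
    [&&] would be computed, and this test is the inner loop of all enumerations. *)
Definition distinct3 l := if l is [:: a; b; c]
  then if eqn a b then false else if eqn a c then false else ~~ eqn b c
  else false.

(* The value 3 marks the edge whose two ends are deleted, so the ends of a marked edge
   are unconstrained. *)
Definition marked l := if l is [:: a; b; c]
  then if eqn a 3 then true else if eqn b 3 then true else eqn c 3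
  else false.

Definition proper_or_marked l := if marked l then true else distinct3 l.

Lemma distinct3_uniq l : distinct3 l -> uniq l.
Proof.
case: l => [|a [|b [|c [|? ?]]]] //=; rewrite !eqnE !inE.
by case: (a == b); case: (a == c); case: (b == c).
Qed.

Lemma uniq_distinct3 l : size l = 3 -> uniq l -> distinct3 l.
Proof.
case: l => [|a [|b [|c [|? ?]]]] //= _; rewrite !eqnE !inE.
by case: (a == b); case: (a == c); case: (b == c).
Qed.

Lemma marked_mem l : marked l -> 3 \in l.
Proof.
case: l => [|a [|b [|c [|? ?]]]] //=; rewrite !eqnE !inE ![3 == _]eq_sym.
by case: (a == 3); case: (b == 3).
Qed.

(** [s] assigns a side to every vertex and [f] holds the sides of the starting vertices of the
    pending edges. An edge is charged when it is consumed, if its two ends lie on different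
    sides. *)
Fixpoint cost w v (s : nat -> bool) (f : seq bool) :=
  match w with
  | [::] => 0
  | V j :: w => count (fun b => b != s v) (take j f) + cost w v.+1 s (nseq (3 - j) (s v) ++ drop j f)
  | P i :: w => cost w v s (pull i f)
  end.

Lemma cost_count w f c v s (si ta : nat -> bool) :
    (forall k e, k < size (inc w f c) -> e \in (nth ([::], [::]) (inc w f c) k).2 -> si e = s (v + k)) ->
    (forall k e, k < size (inc w f c) -> e \in (nth ([::], [::]) (inc w f c) k).1 -> ta e = s (v + k)) ->
  cost w v s (map si f) = count (fun e => si e != ta e) (flatten (map fst (inc w f c))).
Proof.
elim: w f c v => [|[j|i] w IHw] f c v //= siP taP; last by rewrite -map_pull; apply: IHw.
have -> : nseq (3 - j) (s v) = map si (iota c (3 - j)).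
  have /all_pred1P: all (pred1 (s v)) (map si (iota c (3 - j))).
    by apply/allP=> _ /mapP[e ec ->]; rewrite /= (siP 0 e) ?addn0.
  by rewrite size_map size_iota => ->.
rewrite -map_take -map_drop -map_cat (IHw _ (c + (3 - j))).
- rewrite count_cat count_map; congr (_ + _); apply: eq_in_count => e ec /=.
  by rewrite (taP 0 e) ?addn0.
- by move=> k e kn ek; rewrite addSnnS; apply: siP.
by move=> k e kn ek; rewrite addSnnS; apply: taP.
Qed.

(** * The cubic multigraph of a word without pending edges *)

Section ClosedWord.
Variable w : word.
Hypothesis closed : arity w 0 == Some 0.
Let n := nverts w.
Let m := nids w.
Let I := inc w [::] 0.

Lemma out_closed : out w [::] 0 = [::].
Proof. by apply: size0nil; apply: size_out; apply/eqP. Qed.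

Lemma consumed_perm : perm_eq (flatten (map fst I)) (iota 0 m).
Proof. by have := inc_consumed w [::] 0; rewrite out_closed cats0. Qed.

Definition src_nat e := find (fun l => e \in l) (map snd I).
Definition dst_nat e := find (fun l => e \in l) (map fst I).

Lemma src_lt (e : 'I_m) : src_nat e < n.
Proof.
have -> : n = size (map snd I) by rewrite size_map size_inc.
rewrite -has_find; apply/hasP.
have: val e \in flatten (map snd I) by rewrite inc_pushed mem_iota ltn_ord.
by case/flattenP=> l lI el; exists l.
Qed.

Lemma dst_lt (e : 'I_m) : dst_nat e < n.
Proof.
have -> : n = size (map fst I) by rewrite size_map size_inc.
rewrite -has_find; apply/hasP.
have: val e \in flatten (map fst I) by rewrite (perm_mem consumed_perm) mem_iota ltn_ord.
by case/flattenP=> l lI el; exists l.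
Qed.

Definition src e : 'I_n := Ordinal (src_lt e).
Definition dst e : 'I_n := Ordinal (dst_lt e).

Lemma mem_pushed (e : 'I_m) (x : 'I_n) : (val e \in (nth ([::], [::]) I x).2) = (src e == x).
Proof.
rewrite -(nth_map _ [::] snd) ?size_inc // find_flatten ?size_map ?size_inc //.
  by rewrite inc_pushed mem_iota ltn_ord.
by rewrite inc_pushed iota_uniq.
Qed.

Lemma mem_consumed (e : 'I_m) (x : 'I_n) : (val e \in (nth ([::], [::]) I x).1) = (dst e == x).
Proof.
rewrite -(nth_map _ [::] fst) ?size_inc // find_flatten ?size_map ?size_inc //.
  by rewrite (perm_mem consumed_perm) mem_iota ltn_ord.
by rewrite (perm_uniq consumed_perm) iota_uniq.
Qed.

Lemma word_deg3 x : #|[set e | src e == x]| + #|[set e | dst e == x]| = 3.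
Proof.
have card_ids (l : seq nat) : uniq l -> {subset l <= iota 0 m} ->
    #|[set e : 'I_m | val e \in l]| = size l.
  move=> ul lm; rewrite cardE -(size_map val); apply: perm_size; apply: uniq_perm => //.
    by rewrite (map_inj_uniq val_inj) enum_uniq.
  move=> i; apply/mapP/idP=> [[e]|il]; first by rewrite mem_enum inE => el ->.
  have im : i < m by have := lm i il; rewrite mem_iota.
  by exists (Ordinal im); rewrite ?mem_enum ?inE.
have xI : nth ([::], [::]) I x \in I by rewrite mem_nth // size_inc.
have /allP/(_ _ xI)/eqP <- := @inc_cubic w [::] 0 0 (eqP closed).
rewrite addnC -!card_ids.
- by congr (_ + _); apply: eq_card => e; rewrite !inE (mem_consumed, mem_pushed).
- by apply: uniq_in_flatten (map_f snd xI); rewrite inc_pushed iota_uniq.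
- by move=> e ex; rewrite -(inc_pushed w [::]); apply/flattenP; exists (nth ([::], [::]) I x).2; rewrite ?map_f.
- by apply: uniq_in_flatten (map_f fst xI); rewrite (perm_uniq consumed_perm) iota_uniq.
move=> e ex; rewrite -(perm_mem consumed_perm); apply/flattenP.
by exists (nth ([::], [::]) I x).1; rewrite ?map_f.
Qed.

Lemma incident_word (e : 'I_m) (x : 'I_n) :
  (e \in incident src dst x) = (val e \in (nth ([::], [::]) I x).1 ++ (nth ([::], [::]) I x).2).
Proof. by rewrite inE mem_cat mem_consumed mem_pushed orbC. Qed.

(** Vertex sets as predicates on numbers, the form in which [cost] takes them. *)
Definition joined (A : {set 'I_n}) i := i \in map val (enum A).

Lemma joined_ord (A : {set 'I_n}) (x : 'I_n) : joined A x = (x \in A).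
Proof. by rewrite /joined mem_map ?mem_enum //; apply: val_inj. Qed.

Lemma cost_boundary (A : {set 'I_n}) :
  cost w 0 (joined A) [::] = #|boundary src dst A|.
Proof.
pose si e := joined A (src_nat e); pose ta e := joined A (dst_nat e).
rewrite (@cost_count w [::] 0 0 _ si ta).
- rewrite (permP consumed_perm) -sum1_count -[m in iota 0 m]subn0 -/(index_iota 0 m) big_mkord -sum1_card.
  apply: eq_bigl => e; rewrite inE /si /ta.
  by rewrite -[src_nat e]/(val (src e)) -[dst_nat e]/(val (dst e)) !joined_ord.
- move=> k e; rewrite size_inc => kn ek; rewrite add0n /si.
  have em : e < m.
    have: e \in flatten (map snd I).
      by apply/flattenP; exists (nth ([::], [::]) I k).2; rewrite ?map_f ?mem_nth ?size_inc.
    by rewrite inc_pushed mem_iota.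
  by have := mem_pushed (Ordinal em) (Ordinal kn); rewrite ek => /esym/eqP/(congr1 val) /= ->.
- move=> k e; rewrite size_inc => kn ek; rewrite add0n /ta.
  have em : e < m.
    have: e \in flatten (map fst I).
      by apply/flattenP; exists (nth ([::], [::]) I k).1; rewrite ?map_f ?mem_nth ?size_inc.
    by rewrite (perm_mem consumed_perm) mem_iota.
  by have := mem_consumed (Ordinal em) (Ordinal kn); rewrite ek => /esym/eqP/(congr1 val) /= ->.
Qed.

Lemma exec_proper ok cs : size cs = m -> exec ok w [::] cs <> None ->
  forall x : 'I_n, let J := nth ([::], [::]) I x in ok (map (nth 0 cs) (J.1 ++ J.2)).
Proof.
move=> sz; have ecs : map (nth 0 cs) (iota 0 (nids w)) = cs.
  by rewrite -[nids w]sz map_nth_iota0 ?take_size.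
have := exec_map ok (nth 0 cs) w [::] 0; rewrite ecs /= => ->.
by case: allP => // okI _ x; apply: okI; rewrite mem_nth ?size_inc.
Qed.

(** The type ['I_k.-1.+1] makes [inord] applicable and is convertible to ['I_3] and ['I_4] at the
    two values of [k] in use. *)
Lemma colouring_of_stream k cs (x : 'I_n) : all (fun c => c < 4) cs -> 0 < k -> k <= 4 ->
    let J := nth ([::], [::]) I x in
    distinct3 (map (nth 0 cs) (J.1 ++ J.2)) ->
    (forall e : 'I_m, e \in incident src dst x -> nth 0 cs e < k) ->
  {in incident src dst x &, injective (fun e : 'I_m => inord (nth 0 cs e) : 'I_k.-1.+1)}.
Proof.
move=> cs4 k0 k4 J dJ ltk e f xe xf /(congr1 val) /=.
rewrite !inordK ?prednK ?ltk // => ef; apply: val_inj.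
by apply: map_uniq_inj (distinct3_uniq dJ) _ _ _ _ ef; rewrite -incident_word.
Qed.

Lemma mem_inc_lt (x : 'I_n) i : let J := nth ([::], [::]) I x in i \in J.1 ++ J.2 -> i < m.
Proof.
have xI : nth ([::], [::]) I x \in I by rewrite mem_nth ?size_inc.
rewrite /= mem_cat => /orP[] ix.
  have: i \in flatten (map fst I) by apply/flattenP; exists (nth ([::], [::]) I x).1; rewrite ?map_f.
  by rewrite (perm_mem consumed_perm) mem_iota.
have: i \in flatten (map snd I) by apply/flattenP; exists (nth ([::], [::]) I x).2; rewrite ?map_f.
by rewrite inc_pushed mem_iota.
Qed.

(** A vertex away from [e] sees no colour 3, so [proper_or_marked] reduces there to [distinct3] on
    colours below 3. The value of [inord] on the mark itself is irrelevant: it matters only at the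
    ends of [e]. *)
Lemma critical_of_stream cs (e : 'I_m) : size cs = m -> all (fun c => c < 4) cs ->
    (forall f : 'I_m, (nth 0 cs f == 3) = (f == e)) -> exec proper_or_marked w [::] cs <> None ->
  exists col : 'I_m -> 'I_3,
    forall x, x != src e -> x != dst e -> {in incident src dst x &, injective col}.
Proof.
move=> sz cs4 mark ex; exists (fun f : 'I_m => inord (nth 0 cs f)) => x xs xd.
have nm (f : 'I_m) : f \in incident src dst x -> nth 0 cs f != 3.
  rewrite mark; apply: contraL => /eqP->.
  by rewrite inE negb_or ![_ == x]eq_sym xs.
have := exec_proper sz ex x; rewrite /proper_or_marked => /orP[/marked_mem/mapP[i iJ i3]|dJ].
  have im : i < m := mem_inc_lt iJ.
  by have := nm (Ordinal im); rewrite incident_word iJ /= -i3 eqxx => /(_ isT).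
apply: (colouring_of_stream (k := 3) cs4) => // f xf.
by rewrite ltn_neqAle nm // -ltnS (allP cs4) ?mem_nth ?sz.
Qed.

Lemma four_colouring_of_stream cs : size cs = m -> all (fun c => c < 4) cs ->
    exec distinct3 w [::] cs <> None ->
  exists col : 'I_m -> 'I_4, forall x, {in incident src dst x &, injective col}.
Proof.
move=> sz cs4 ex; exists (fun f : 'I_m => inord (nth 0 cs f)) => x.
apply: (colouring_of_stream (k := 4) cs4) => // [|f xf]; first exact: exec_proper.
by rewrite (allP cs4) ?mem_nth ?sz.
Qed.

(** Both [u] and [v] are built after [w1]. A colouring that is proper elsewhere is proper at every
    vertex of [w1], hence restricts to a successful run of [w1]. *)
Lemma uncolourable_of_prefix w1 w2 (u v : 'I_n) : w = w1 ++ w2 ->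
    nverts w1 <= u -> nverts w1 <= v ->
    (forall cs, all (fun c => c < 3) cs -> size cs = nids w1 -> exec distinct3 w1 [::] cs = None) ->
  ~ (exists col : 'I_m -> 'I_3,
       forall x, x \notin [set u; v] -> {in incident src dst x &, injective col}).
Proof.
move=> ww wu wv unc [col colP].
pose ka i := if insub i is Some e then val (col e) else 0.
have kaE (e : 'I_m) : ka e = col e by rewrite /ka valK.
have := unc (map ka (iota 0 (nids w1))); rewrite size_map size_iota => /(_ _ erefl).
rewrite -[[::]]/(map ka [::]) exec_map ifT => [/(_ _)|].
  have -> // : all (fun c => c < 3) (map ka (iota 0 (nids w1))).
  apply/allP=> _ /mapP[i _ ->]; rewrite /ka; case: insubP => // e _ _; exact: ltn_ord.
  by move=> /(_ isT).
apply/allP=> J /(nthP ([::], [::]))[k kn Jk].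
have JI : nth ([::], [::]) I k = J by rewrite /I ww inc_cat nth_cat kn.
rewrite size_inc in kn.
have xn : k < n by apply: leq_trans kn (leq_trans wu (ltnW (ltn_ord u))).
have ids (i : nat) : i \in J.1 ++ J.2 -> i < m.
  by rewrite -JI; apply: (@mem_inc_lt (Ordinal xn)).
apply: uniq_distinct3.
  have /allP/(_ J) := @inc_cubic w [::] 0 0 (eqP closed).
  by rewrite size_map size_cat -JI => /(_ _)/eqP-> //; rewrite mem_nth ?size_inc.
rewrite map_inj_in_uniq.
  have /allP-> // := @inc_uniq w [::] 0 isT isT.
  by rewrite -JI mem_nth ?size_inc.
move=> i i' iJ iJ'; rewrite -[i]/(val (Ordinal (ids i iJ))) -[i']/(val (Ordinal (ids i' iJ'))) !kaE.
move=> /val_inj eq_col; congr val; apply: (colP (Ordinal xn)) eq_col.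
- by rewrite !inE -!val_eqE /= negb_or !neq_ltn (leq_trans kn wu) (leq_trans kn wv).
- by rewrite incident_word JI.
by rewrite incident_word JI.
Qed.
End ClosedWord.

(** * Cuts *)

Arguments Nat.leb : simpl never.

(* A profile [(c, a, b)] is the size of a cut and the sizes, capped at 4, of its sides;
   only the profiles that are not dominated, with [c < 6], are kept.  They are indexed
   by the sides of the starting vertices of the pending edges. *)
Notation profile := (nat * nat * nat)%type.

(** A smaller cut with larger sides is the greater threat to expansion, and it remains so whatever
    follows, since cuts and sides only grow by equal amounts. Hence dominated profiles may be
    forgotten. *)
Definition dominates (y z : profile) :=
  let: (c, a, b) := y in let: (c', a', b') := z in
  if Nat.leb c c' then if Nat.leb a' a then Nat.leb b' b else false else false.

Arguments dominates : simpl never.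

Definition cap a := if a is _.+4 then 4 else a.

Fixpoint has_dom (z : profile) l := if l is y :: l then if dominates y z then true else has_dom z l else false.

Fixpoint prune (z : profile) l :=
  if l is y :: l then if dominates z y then prune z l else y :: prune z l else [::].

Definition insert z l := if has_dom z l then l else z :: prune z l.

Fixpoint insert_all l1 l2 := if l1 is z :: l1 then insert_all l1 (insert z l2) else l2.

(** A finite map from lists of sides to lists of profiles. The left subtrie belongs to [false], and
    operations on the front of the pending list act near the root. *)
Inductive trie := Tip | Node of seq profile & trie & trie.

Definition node l t u := match l, t, u with [::], Tip, Tip => Tip | _, _, _ => Node l t u end.

Arguments node : simpl never.

Fixpoint lookup t (f : seq bool) :=
  match t, f with
  | Tip, _ => [::]
  | Node l _ _, [::] => l
  | Node _ t u, x :: f => lookup (if x then u else t) f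
  end.

Fixpoint trie_merge t u :=
  match t, u with
  | Tip, _ => u
  | _, Tip => t
  | Node l a b, Node l' a' b' => Node (insert_all l l') (trie_merge a a') (trie_merge b b')
  end.

Fixpoint shift_profiles m (s : bool) (l : seq profile) :=
  if l is (c, a, b) :: l then
    let c' := Nat.add c m in
    if Nat.leb 6 c' then shift_profiles m s l
    else (if s then (c', a, cap b.+1) else (c', cap a.+1, b)) :: shift_profiles m s l
  else [::].

Fixpoint shift m s t :=
  if t is Node l a b then node (shift_profiles m s l) (shift m s a) (shift m s b) else Tip.

(** The new vertex lies on side [s]; [m] accumulates the consumed edges that come from the other
    side. *)
Fixpoint pop j m (s : bool) t :=
  if j is j.+1 then
    if t is Node _ a b then
      trie_merge (pop j (if s then m.+1 else m) s a) (pop j (if s then m else m.+1) s b)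
    else Tip
  else shift m s t.

Fixpoint push k (s : bool) t :=
  if k is k.+1 then
    let u := push k s t in if s then node [::] Tip u else node [::] u Tip
  else t.

Fixpoint select i (b : bool) t :=
  if t is Node _ x y then
    if i is i.+1 then node [::] (select i b x) (select i b y) else if b then y else x
  else Tip.

(** Dynamic programming over all bipartitions at once: at [V j] the new vertex is tried on both
    sides and the results are merged. *)
Fixpoint trie_run w t :=
  match w with
  | [::] => t
  | V j :: w => trie_run w (trie_merge (push (3 - j) false (pop j 0 false t)) (push (3 - j) true (pop j 0 true t)))
  | P i :: w => trie_run w (node [::] (select i false t) (select i true t))
  end.

Fixpoint subtrie t u :=
  match t, u with
  | Tip, _ => true
  | Node l a b, Node l' a' b' =>
      if all (fun z => has_dom z l') l then if subtrie a a' then subtrie b b' else false else false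
  | _, _ => false
  end.

Lemma lebE : Nat.leb =2 leq.
Proof. by elim=> [|m IHm] [|n] //; apply: IHm. Qed.

Lemma capE a : cap a = minn a 4.
Proof. by case: a => [|[|[|[|a]]]] //; rewrite (minn_idPr _). Qed.

Lemma domE y z : dominates y z = [&& y.1.1 <= z.1.1, z.1.2 <= y.1.2 & z.2 <= y.2].
Proof. by case: y z => [[c a] b] [[c' a'] b']; rewrite /dominates !lebE; do !case: ifP. Qed.

Lemma dom_trans y x z : dominates x y -> dominates y z -> dominates x z.
Proof.
rewrite !domE => /and3P[a b c] /and3P[a' b' c'].
by rewrite (leq_trans a) // (leq_trans b') // (leq_trans c').
Qed.

Lemma has_domE z l : has_dom z l = has (dominates^~ z) l.
Proof. by elim: l => //= y l ->; case: dominates. Qed.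

Definition covers t f (z : profile) :=
  let: (c, a, b) := z in has_dom (c, cap a, cap b) (lookup t f).

Arguments covers : simpl never.

Lemma insert_dom z y l : dominates y z || has_dom z l -> has_dom z (insert y l).
Proof.
rewrite /insert !has_domE; case: ifP => yl.
  case/orP=> // yz; case/hasP: yl => x xl xy.
  by apply/hasP; exists x => //; apply: dom_trans yz.
case/orP=> [yz|/hasP[x xl xz]] /=; first by rewrite yz.
have [yz|nyz] //= := boolP (dominates y z); elim: l xl {yl} => //= u l IHl.
rewrite inE => /orP[/eqP<-|/IHl hl]; case: ifP => //= yx; last by rewrite hl orbT.
  by rewrite (dom_trans yx xz) in nyz.
by rewrite xz.
Qed.

Lemma insert_all_dom z l1 l2 : has_dom z l1 || has_dom z l2 -> has_dom z (insert_all l1 l2).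
Proof.
elim: l1 l2 => [|y l1 IHl] l2 //= h; apply: IHl; move: h; case: ifP => [yz _|nyz].
  by rewrite insert_dom ?orbT // yz.
by case/orP=> [->//|h]; rewrite insert_dom ?orbT // h orbT.
Qed.

Lemma lookup_node l t u f : lookup (node l t u) f = lookup (Node l t u) f.
Proof. by case: l t u => [|? ?] [|? ? ?] [|? ? ?] //; case: f => [|[] f]. Qed.

Lemma covers_merge t u f z : covers t f z || covers u f z -> covers (trie_merge t u) f z.
Proof.
case: z => [[c a] b]; rewrite /covers; elim: t u f => [|l x IHx y IHy] [|l' x' y'] f //=.
  by rewrite orbF.
by case: f => [|[] f] /=; [apply: insert_all_dom | apply: IHy | apply: IHx].
Qed.

Lemma cap_succ a a' : cap a <= a' -> cap a.+1 <= cap a'.+1.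
Proof.
rewrite !capE leq_min geq_minr andbT => h; apply: leq_trans (_ : (minn a 4).+1 <= _) => //.
by rewrite -minnSS leq_min geq_minl (leq_trans (geq_minr _ _)).
Qed.

Lemma covers_shift m (s : bool) t f c a b : covers t f (c, a, b) ->
  (6 <= c + m) || covers (shift m s t) f (c + m, ~~ s + a, s + b).
Proof.
rewrite /covers; have [//|lt6] := leqP 6 (c + m); rewrite [_ || _]/=.
elim: t f => [|l x IHx y IHy] f //=; rewrite lookup_node.
case: f => [|[] f] /=; [|exact: IHy|exact: IHx].
elim: l => //= -[[c' a'] b'] l IHl; case: ifP => [d _|_ /IHl h]; last first.
  by case: ifP => // _ /=; case: ifP.
move: d; rewrite domE /= => /and3P[cc aa bb].
rewrite lebE ifN; last by rewrite -ltnNge (leq_ltn_trans _ lt6) // leq_add2r.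
by case: s {IHx IHy IHl} => /=; rewrite domE /= leq_add2r cc ?cap_succ // ?aa ?bb.
Qed.

Lemma covers_pop j m (s : bool) t f c a b : j <= size f -> covers t f (c, a, b) ->
  let m' := m + count (fun x => x != s) (take j f) in
  (6 <= c + m') || covers (pop j m s t) (drop j f) (c + m', ~~ s + a, s + b).
Proof.
elim: j m t f => [|j IHj] m t f /=; first by rewrite take0 drop0 addn0 => _; apply: covers_shift.
case: f => // x f; rewrite ltnS => jf; case: t => // l t u cov /=.
have {}cov : covers (if x then u else t) f (c, a, b) by [].
have h m' := IHj m' _ _ jf cov; have := h (if x != s then m.+1 else m).
have -> : (if x != s then m.+1 else m) + count (fun x => x != s) (take j f) =
    m + ((x != s) + count (fun x => x != s) (take j f)).
  by case: (x != s); rewrite ?addSn ?addnS.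
case/orP=> [->//|cov']; apply/orP; right; apply: covers_merge.
by move: cov'; case: x {h cov}; case: s {IHj} => /= ->; rewrite ?orbT.
Qed.

Lemma covers_push k (s : bool) t f z : covers t f z -> covers (push k s t) (nseq k s ++ f) z.
Proof.
case: z => [[c a] b]; elim: k => //= k IHk /IHk.
by case: s {IHk} => /=; rewrite /covers lookup_node.
Qed.

Lemma covers_select i t f z x : drop i f = x :: drop i.+1 f -> covers t f z ->
  covers (select i x t) (take i f ++ drop i.+1 f) z.
Proof.
case: z => [[c a] b]; elim: i t f => [|i IHi] [|l t u] [|y f] //=.
  by rewrite drop0 => -[->]; case: x.
by move=> /IHi h; rewrite /covers lookup_node /=; case: y => /h.
Qed.

Fixpoint sides w v (s : nat -> bool) f :=
  match w with
  | [::] => f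
  | V j :: w => sides w v.+1 s (nseq (3 - j) (s v) ++ drop j f)
  | P i :: w => sides w v s (pull i f)
  end.

(** The soundness invariant of the dynamic programming: every bipartition either already cuts six
    edges or is represented by a profile that dominates its own. It survives each letter because
    adding cut edges and vertices, even with capped sizes, is monotone. *)
Lemma covers_trun w v s t f c a b k : arity w (size f) = Some k -> covers t f (c, a, b) ->
  let n := nverts w in
  (6 <= c + cost w v s f) ||
  covers (trie_run w t) (sides w v s f)
    (c + cost w v s f, a + count (fun x => ~~ s x) (iota v n), b + count s (iota v n)).
Proof.
elim: w v t f c a b => [|[j|i] w IHw] v t f c a b /=; first by rewrite !addn0 => _ ->; rewrite orbT.
  case: ifP => // /andP[jf j3] ar cov.
  have /orP[ge6|cov'] := covers_pop 0 (s v) jf cov.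
    by rewrite addnA (leq_trans ge6) // leq_addr.
  rewrite add0n in cov'; rewrite (addnA c) (addnA a) (addnA b) (addnC a) (addnC b).
  apply: IHw; first by rewrite size_cat size_nseq size_drop.
  by apply: covers_merge; case: (s v) cov' => cov'; rewrite covers_push ?orbT.
case: ifP => // lt ar cov; apply: IHw; first by rewrite size_pull.
have Ed : drop i f = nth false f i :: drop i.+1 f by rewrite -drop_nth.
have := covers_select Ed cov; rewrite /pull Ed /covers lookup_node /=.
by case: nth.
Qed.

Lemma covers_sub t u f z : subtrie t u -> covers t f z -> covers u f z.
Proof.
case: z => [[c a] b]; rewrite /covers; elim: t u f => [|l x IHx y IHy] [|l' x' y'] f //=.
do 2!case: ifP => //; move=> xx /allP ll yy; case: f => [|[] f] /=; [|exact: IHy|exact: IHx].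
rewrite {1}has_domE => /hasP[z zl dz]; have := ll z zl; rewrite !has_domE => /hasP[z' zl' dz'].
by apply/hasP; exists z' => //; apply: dom_trans dz.
Qed.

(** The expansion inequality on capped sizes. Since only cuts below 6 are kept, a surviving profile
    with both sides equal to 4 fails the test. *)
Definition expanding (z : profile) :=
  let: (c, a, b) := z in
  match a, b with 0, _ => true | _, 0 => true | _, _ => (minn a b).+2 <= c end.

Definition root_profiles t := if t is Node l _ _ then l else [::].
Lemma cost_cat w1 w2 v s f :
  cost (w1 ++ w2) v s f = cost w1 v s f + cost w2 (v + nverts w1) s (sides w1 v s f).
Proof.
elim: w1 v f => [|[j|i] w IHw] v f /=; first by rewrite addn0.
  by rewrite IHw addSnnS addnA.
exact: IHw.
Qed.

Lemma sides_cat w1 w2 v s f :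
  sides (w1 ++ w2) v s f = sides w2 (v + nverts w1) s (sides w1 v s f).
Proof.
elim: w1 v f => [|[j|i] w IHw] v f /=; first by rewrite addn0.
  by rewrite IHw addSnnS.
exact: IHw.
Qed.

Lemma size_sides w v s f a : arity w (size f) = Some a -> size (sides w v s f) = a.
Proof.
elim: w v f => [|[j|i] w IHw] v f /=; first by case.
  by case: ifP => // _ ar; apply: IHw; rewrite size_cat size_nseq size_drop.
by case: ifP => // _ ar; apply: IHw; rewrite size_pull.
Qed.

Definition repeat k (y : word) := flatten (nseq k y).

Lemma arity_repeat k y a : arity y a = Some a -> arity (repeat k y) a = Some a.
Proof. by rewrite /repeat => ya; elim: k => //= k IHk; rewrite arity_cat ya. Qed.

Lemma nverts_repeat k y : nverts (repeat k y) = k * nverts y.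
Proof. by rewrite /repeat; elim: k => //= k IHk; rewrite nverts_cat IHk. Qed.

Lemma nids_repeat k y : nids (repeat k y) = k * nids y.
Proof. by rewrite /repeat; elim: k => //= k IHk; rewrite nids_cat IHk. Qed.

Lemma covers_repeat k y inv v s f c a b : arity y (size f) = Some (size f) ->
    subtrie (trie_run y inv) inv -> covers inv f (c, a, b) ->
  let w := repeat k y in
  let n := nverts w in
  (6 <= c + cost w v s f) ||
  covers inv (sides w v s f)
    (c + cost w v s f, a + count (fun x => ~~ s x) (iota v n), b + count s (iota v n)).
Proof.
rewrite /repeat => ar sub; elim: k v f ar c a b => [|k IHk] v f ar c a b cov /=.
  by rewrite !addn0 cov orbT.
rewrite cost_cat sides_cat nverts_cat iotaD !count_cat !addnA.
have /orP[ge6|cov'] := covers_trun v s ar cov; first by rewrite (leq_trans ge6) // leq_addr.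
apply: IHk (covers_sub sub cov').
by rewrite (size_sides v s ar).
Qed.

Definition start_trie := Node [:: (0, 0, 0)] Tip Tip.

(* [inv] over-approximates the profiles reachable after any number of copies of [y]. *)
Definition expansion_check w1 y w2 inv :=
  [&& subtrie (trie_run w1 start_trie) inv, subtrie (trie_run y inv) inv
    & all expanding (root_profiles (trie_run w2 inv))].

Lemma expansion w1 y w2 inv k r (s : nat -> bool) :
    arity w1 0 = Some r -> arity y r = Some r -> arity w2 r = Some 0 ->
    expansion_check w1 y w2 inv ->
  let w := w1 ++ repeat k y ++ w2 in
  let a := count (fun x => ~~ s x) (iota 0 (nverts w)) in
  let b := count s (iota 0 (nverts w)) in
  0 < a -> 0 < b -> minn (minn a b) 4 + 2 <= cost w 0 s [::].
Proof.
move=> ar1 ary ar2 /and3P[sub1 sub2 chk] w a b a0 b0.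
(* Cuts of six or more edges need no inspection, because the bound to be proved never exceeds 4 +
   2. *)
suff: (6 <= cost w 0 s [::]) || covers (trie_run w2 inv) [::] (cost w 0 s [::], a, b).
  case/orP=> [h|]; first by apply: leq_trans h; rewrite (leq_add2r 2 _ 4) geq_minr.
  rewrite /covers; case: (trie_run w2 inv) chk => [|l t u] //= /allP chk.
  rewrite has_domE => /hasP[[[c' a'] b'] /chk ex]; rewrite domE /= !capE => /and3P[cc aa bb].
  have a'0 : 0 < a' by apply: leq_trans aa; rewrite leq_min a0.
  have b'0 : 0 < b' by apply: leq_trans bb; rewrite leq_min b0.
  apply: leq_trans cc; apply: (@leq_trans (minn a' b').+2).
    rewrite addn2 !ltnS leq_min; apply/andP; split.
      by apply: leq_trans aa; rewrite leq_min (leq_trans (geq_minl _ _)) ?geq_minl // geq_minr.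
    by apply: leq_trans bb; rewrite leq_min (leq_trans (geq_minl _ _)) ?geq_minr // geq_minr.
  by move: ex a'0 b'0; rewrite /expanding; case: a' {aa} => // a'; case: b' {bb}.
have ar0 : arity w1 (size ([::] : seq bool)) = Some r by [].
have cov0 : covers start_trie [::] (0, 0, 0) by [].
rewrite /a /b /w cost_cat cost_cat !nverts_cat !iotaD !count_cat !add0n !addnA.
have /orP[ge6|cov1] := covers_trun 0 s ar0 cov0.
  by rewrite -!addnA (leq_trans ge6) // leq_addr.
set f1 := sides w1 0 s [::] in cov1 *.
have sz1 : size f1 = r := size_sides 0 s ar0.
have ary1 : arity y (size f1) = Some (size f1) by rewrite sz1.
have /orP[ge6|cov2] := covers_repeat k (nverts w1) s ary1 sub2 (covers_sub sub1 cov1).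
  by rewrite add0n in ge6; rewrite (leq_trans ge6) // leq_addr.
have ar2' : arity w2 (size (sides (repeat k y) (nverts w1) s f1)) = Some 0.
  by rewrite (@size_sides _ _ _ _ r) // sz1 arity_repeat.
have := covers_trun (nverts w1 + nverts (repeat k y)) s ar2' cov2.
have := size_sides (nverts w1 + nverts (repeat k y)) s ar2'.
by case: (sides w2 _ _ _) => // _; rewrite !add0n.
Qed.

(** * Lengthening a chain of blocks *)

Fixpoint tuples k : seq (seq nat) :=
  if k is k.+1 then flatten [seq map (cons c) (tuples k) | c <- [:: 0; 1; 2]] else [:: [::]].

Fixpoint runs ok w (f : seq nat) : seq (seq nat) :=
  match w with
  | [::] => [:: f]
  | V j :: w => flatten [seq if ok (take j f ++ o) then runs ok w (o ++ drop j f) else [::]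
                        | o <- tuples (3 - j)]
  | P i :: w => runs ok w (pull i f)
  end.

Lemma mem_tuples k o : (o \in tuples k) = (size o == k) && all (fun c => c < 3) o.
Proof.
elim: k o => [|k IHk] o; first by rewrite inE; case: o.
apply/flatten_mapP/idP=> [[c cP /mapP[o' oP ->]]|].
  by rewrite IHk in oP; case/andP: oP => /= /eqP-> ->; rewrite eqxx /= andbT; move: c cP; apply/allP.
case: o => //= c o; rewrite eqSS => /and3P[so c3 o3]; exists c; last by rewrite map_f // IHk so.
by case: c c3 => [|[|[|c]]].
Qed.

Lemma runsP ok w f g : reflect
  (exists cs, [/\ size cs = nids w, all (fun c => c < 3) cs & exec ok w f cs = Some g])
  (g \in runs ok w f).
Proof.
elim: w f => [|[j|i] w IHw] f /=; last exact: IHw.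
  rewrite inE; apply: (iffP eqP) => [->|[cs [_ _ []]]] //; by exists [::].
apply: (iffP flatten_mapP) => [[o]|[cs [sz cs3]]].
  rewrite mem_tuples => /andP[/eqP so o3]; case: ifP => // oko /IHw[cs [sz cs3 ex]].
  exists (o ++ cs); rewrite size_cat so sz all_cat o3; split=> //.
  by rewrite -so take_size_cat // drop_size_cat // oko.
case: ifP => // oko ex; exists (take (3 - j) cs).
  by rewrite mem_tuples size_takel ?sz ?leq_addr // eqxx; apply/allP=> c /mem_take; move: c; apply/allP.
rewrite oko; apply/IHw; exists (drop (3 - j) cs).
by rewrite size_drop sz addKn; split=> //; apply/allP=> c /mem_drop; move: c; apply/allP.
Qed.

Definition stable ok y f := f \in runs ok y f.

Lemma stable_repeat ok y f k : (0 < k -> stable ok y f) ->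
  exists cs, [/\ size cs = nids (repeat k y), all (fun c => c < 3) cs
             & exec ok (repeat k y) f cs = Some f].
Proof.
case: k => [_|k /(_ isT)/runsP[cs [sz cs3 ex]]]; first by exists [::].
elim: {k}k.+1 => [|k [cs' [sz' cs3' ex']]]; first by exists [::].
exists (cs ++ cs'); rewrite nids_cat size_cat all_cat cs3 sz sz'; split=> //.
by rewrite /repeat /= exec_cat // ex.
Qed.

Lemma repeatD p q y : repeat (p + q) y = repeat p y ++ repeat q y.
Proof. by rewrite /repeat -flatten_cat -nseqD. Qed.

Lemma repeatS k y : repeat k.+1 y = y ++ repeat k y.
Proof. by []. Qed.

Section Extension.
Variables (w1 y w2 : word).
Hypothesis y_gt0 : 0 < nids y.

(* A run through two copies of [y] extends to [k] copies, because the state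
   before the first or after the second copy can be repeated. *)
Lemma extend ok a b d s0 s2 g p q :
    size a = nids w1 -> size b = nids (y ++ y) ->
    exec ok w1 [::] a = Some s0 -> exec ok (y ++ y) s0 b = Some s2 -> exec ok w2 s2 d = Some g ->
    (0 < p -> stable ok y s0) -> (0 < q -> stable ok y s2) ->
  exists cp cq, [/\ size cp = p * nids y, size cq = q * nids y,
    all (fun c => c < 3) cp, all (fun c => c < 3) cq
    & exec ok (w1 ++ repeat (p + (2 + q)) y ++ w2) [::] (a ++ cp ++ b ++ cq ++ d) = Some g].
Proof.
move=> sa sb exa exb exd /stable_repeat[cp [szp p3 exp]] /stable_repeat[cq [szq q3 exq]].
exists cp, cq; rewrite -!nids_repeat; split=> //.
rewrite !repeatD {2}/repeat /= cats0 -!catA.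
by rewrite exec_cat // exa /= exec_cat // exp /= catA exec_cat // exb /= exec_cat // exq.
Qed.

Definition split_stream (cs : seq nat) :=
  let n1 := nids w1 in let n2 := nids (y ++ y) in
  (take n1 cs, take n2 (drop n1 cs), drop n2 (drop n1 cs)).

(** The stream colours the graph with exactly two copies of [y]. The flags tell on which sides of
    these copies further ones will be inserted; only the state at such a side has to be
    repeatable. *)
Definition stream_check ok (left right : bool) cs :=
  let: (a, b, d) := split_stream cs in
  if exec ok w1 [::] a is Some s0 then
    if exec ok (y ++ y) s0 b is Some s2 then
      if exec ok w2 s2 d is Some _ then
        (if left then stable ok y s0 else true) && (if right then stable ok y s2 else true)
      else false
    else false
  else false.

Lemma stream_extend ok left right cs p q :
    size cs = nids w1 + nids (y ++ y) + nids w2 ->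
    stream_check ok left right cs -> (0 < p -> left) -> (0 < q -> right) ->
  let: (a, b, d) := split_stream cs in
  exists cp cq, [/\ size cp = p * nids y, size cq = q * nids y,
    all (fun c => c < 3) cp, all (fun c => c < 3) cq
    & exec ok (w1 ++ repeat (p + (2 + q)) y ++ w2) [::] (a ++ cp ++ b ++ cq ++ d) <> None].
Proof.
rewrite /stream_check /split_stream => sz.
case exa: exec => [s0|] //; case exb: exec => [s2|] //; case exd: exec => [g|] //.
move=> /andP[st0 st2] p0 q0.
have sa : size (take (nids w1) cs) = nids w1 by rewrite size_takel // sz -addnA leq_addr.
have sb : size (take (nids (y ++ y)) (drop (nids w1) cs)) = nids (y ++ y).
  by rewrite size_takel // size_drop sz -addnA addKn leq_addr.
have [| |cp [cq [szp szq p3 q3 ex]]] := extend (p := p) (q := q) sa sb exa exb exd.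
- by move/p0=> l; rewrite l in st0.
- by move/q0=> r; rewrite r in st2.
by exists cp, cq; split=> //; rewrite ex.
Qed.

(** If the marked edge starts in [w1], copies are inserted only after the stored ones; if in the
    first copy, on both sides; if later, only before. The two flags are these three cases. *)
Definition mark_check e cs :=
  [&& size cs == nids w1 + nids (y ++ y) + nids w2, all (fun c => Nat.leb c 3) cs,
      eqn (nth 0 cs e) 3, eqn (count (eqn 3) cs) 1
    & stream_check proper_or_marked (Nat.leb (nids w1) e) (~~ Nat.leb (nids w1 + nids y) e) cs].

Lemma nth_count1 (s : seq nat) x i j : count_mem x s = 1 -> i < size s -> j < size s ->
  nth 0 s i = x -> nth 0 s j = x -> i = j.
Proof.
have in_s (t : seq nat) k : k < size t -> nth 0 t k = x -> count_mem x t != 0.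
  by move=> lt <-; rewrite -lt0n -has_count has_pred1 mem_nth.
elim: s i j => // c s IHs [|i] [|j] //= cnt li lj ix jx.
- by move: (in_s s j lj jx) cnt; rewrite ix eqxx; case: count.
- by move: (in_s s i li ix) cnt; rewrite jx eqxx; case: count.
move: (in_s s i li ix) cnt; case: (c == x) => [|_ cnt]; first by case: count.
by rewrite (IHs i j).
Qed.

Lemma marked_streams k e : 1 < k -> (forall e', e' < nids w1 + nids (y ++ y) + nids w2 ->
      exists cs, mark_check e' cs) ->
    let w := w1 ++ repeat k y ++ w2 in e < nids w ->
  exists cs, [/\ size cs = nids w, all (fun c => c < 4) cs, nth 0 cs e = 3,
    count_mem 3 cs = 1 & exec proper_or_marked w [::] cs <> None].
Proof.
move=> k2 chk w; rewrite /w !nids_cat nids_repeat => ew.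
(* The number of copies preceding the one in which [e] starts, capped so that two copies remain.
   Inserting [p] copies in front brings [e] back to the position [e'] in the graph with two copies;
   truncated subtraction gives [p = 0] when [e] lies in [w1]. *)
pose p := minn ((e - nids w1) %/ nids y) (k - 2); pose q := k - 2 - p.
have kE : k = p + (2 + q) by rewrite addnCA subnKC ?geq_minr // subnKC.
have pe : p * nids y <= e - nids w1.
  by apply: leq_trans (leq_divM _ (nids y)); rewrite leq_mul2r geq_minl orbT.
pose e' := e - p * nids y.
have eE : e = e' + p * nids y by rewrite subnK // (leq_trans pe) ?leq_subr.
have left : 0 < p -> nids w1 <= e'.
  move=> p0; have lt : 0 < p * nids y by rewrite muln_gt0 p0.
  have le : nids w1 <= e by rewrite ltnW // -subn_gt0 (leq_trans lt).
  by rewrite leq_subRL ?(leq_trans pe) ?leq_subr // addnC -leq_subRL.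
have right : 0 < q -> e' < nids w1 + nids y.
  rewrite subn_gt0 => pk; have pE : p = (e - nids w1) %/ nids y.
    by move: pk; rewrite /p gtn_min ltnn orbF => /ltnW/minn_idPl.
  have := ltn_ceil (e - nids w1) y_gt0; rewrite -pE mulSn => lt.
  rewrite ltnNge; apply: contraL lt => h; rewrite -leqNgt leq_subRL.
    by rewrite eE addnA leq_add2r.
  by rewrite eE (leq_trans _ (leq_addr _ _)) // (leq_trans _ h) // leq_addr.
have e'lt : e' < nids w1 + nids (y ++ y) + nids w2.
  case: (posnP q) => [q0|/right lt]; last first.
    by apply: leq_trans lt _; rewrite nids_cat !addnA -addnA leq_addr.
  move: ew; rewrite {1}eE kE q0 addn0 mulnDl -!addnA [e' + _]addnC [nids w1 + (p * _ + _)]addnCA.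
  by rewrite ltn_add2l nids_cat add0n !addnA.
have [cs /and5P[/eqP sz cs3 /eqP ne /eqP cnt chkcs]] := chk e' e'lt.
move: (stream_extend (p := p) (q := q) sz chkcs); rewrite /split_stream.
set a := take _ cs; set bd := drop (nids w1) cs; set b := take _ bd; set d := drop _ bd.
case=> [||cp [cq [szp szq p3 q3 ex]]].
- by move/left; rewrite lebE.
- by move/right; rewrite lebE -ltnNge.
have cs3' : all (fun c => c < 4) cs by apply: sub_all cs3 => c; rewrite lebE ltnS.
have csE : cs = a ++ b ++ d by rewrite !cat_take_drop.
have sa : size a = nids w1 by rewrite size_takel // sz -addnA leq_addr.
have sb : size b = nids (y ++ y).
  by rewrite size_takel // size_drop sz -addnA addKn leq_addr.
have sd : size d = nids w2 by rewrite !size_drop sz -addnA !addKn.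
have no3 (l : seq nat) : all (fun c => c < 3) l -> count_mem 3 l = 0.
  by move=> l3; apply/eqP; rewrite eqn0Ngt -has_count has_pred1; apply/negP=> /(allP l3).
have lt34 (l : seq nat) : all (fun c => c < 3) l -> all (fun c => c < 4) l.
  by apply: sub_all => c; apply: ltnW.
exists (a ++ cp ++ b ++ cq ++ d); split.
- rewrite !size_cat sa sb sd szp szq kE !mulnDl nids_cat mul2n -addnn; congr (_ + _).
  by rewrite -!addnA.
- by move: cs3'; rewrite csE !all_cat (lt34 _ p3) (lt34 _ q3) => /and3P[-> -> ->].
- rewrite eE -ne csE !nth_cat sa.
  case: (ltnP e' (nids w1)) => [lt|ge].
    have p0 : p = 0 by apply/eqP; rewrite -leqn0 leqNgt; apply/negP=> /left; rewrite leqNgt lt.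
    by rewrite p0 mul0n addn0 lt.
  rewrite ifF; last by rewrite ltnNge (leq_trans ge) ?leq_addr.
  rewrite -addnBAC // szp ifF; last by rewrite ltnNge leq_addl.
  rewrite addnK sb; case: (posnP q) => [q0|/right lt].
    by have -> : cq = [::] by [apply: size0nil; rewrite szq q0]; rewrite /= subn0.
  by rewrite nids_cat ltn_subLR // addnA (leq_trans lt) ?leq_addr.
- rewrite !count_cat !(no3 cp, no3 cq) // add0n; move: cnt.
  by rewrite csE !count_cat; congr (_ = _); rewrite -!count_cat; apply: eq_count => c; rewrite eqnE eq_sym.
by rewrite kE.
Qed.

(** Nothing is marked here, so all further copies go in front of the stored two and only the left
    state has to be repeatable. *)
Lemma four_streams k cs : 1 < k -> size cs = nids w1 + nids (y ++ y) + nids w2 ->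
    all (fun c => Nat.leb c 3) cs -> stream_check distinct3 true false cs ->
    let w := w1 ++ repeat k y ++ w2 in
  exists cs', [/\ size cs' = nids w, all (fun c => c < 4) cs' & exec distinct3 w [::] cs' <> None].
Proof.
move=> k2 sz cs3 chk w; rewrite /w !nids_cat nids_repeat.
have kE : k = k - 2 + (2 + 0) by rewrite addn0 subnK.
move: (stream_extend (p := k - 2) (q := 0) sz chk); rewrite /split_stream.
set a := take _ cs; set bd := drop (nids w1) cs; set b := take _ bd; set d := drop _ bd.
case=> [//|//|cp [cq [szp szq p3 q3 ex]]].
have cs3' : all (fun c => c < 4) cs by apply: sub_all cs3 => c; rewrite lebE ltnS.
have csE : cs = a ++ b ++ d by rewrite !cat_take_drop.
have lt34 (l : seq nat) : all (fun c => c < 3) l -> all (fun c => c < 4) l.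
  by apply: sub_all => c; apply: ltnW.
exists (a ++ cp ++ b ++ cq ++ d); rewrite {2}kE; split=> //; last first.
  by move: cs3'; rewrite csE !all_cat (lt34 _ p3) (lt34 _ q3) => /and3P[-> -> ->].
move: sz; rewrite csE !size_cat szp szq mul0n add0n nids_cat addnn -mul2n => sz.
by rewrite addnCA sz -[in RHS](subnK k2) mulnDl -!addnA addnCA.
Qed.

End Extension.

(** * Compressed colourings and their verification *)

Fixpoint hex_bits h : seq bool :=
  match h with
  | Hexadecimal.Nil => [::]
  | Hexadecimal.D0 h => [:: false, false, false, false & hex_bits h]
  | Hexadecimal.D1 h => [:: false, false, false, true & hex_bits h]
  | Hexadecimal.D2 h => [:: false, false, true, false & hex_bits h]
  | Hexadecimal.D3 h => [:: false, false, true, true & hex_bits h]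
  | Hexadecimal.D4 h => [:: false, true, false, false & hex_bits h]
  | Hexadecimal.D5 h => [:: false, true, false, true & hex_bits h]
  | Hexadecimal.D6 h => [:: false, true, true, false & hex_bits h]
  | Hexadecimal.D7 h => [:: false, true, true, true & hex_bits h]
  | Hexadecimal.D8 h => [:: true, false, false, false & hex_bits h]
  | Hexadecimal.D9 h => [:: true, false, false, true & hex_bits h]
  | Hexadecimal.Da h => [:: true, false, true, false & hex_bits h]
  | Hexadecimal.Db h => [:: true, false, true, true & hex_bits h]
  | Hexadecimal.Dc h => [:: true, true, false, false & hex_bits h]
  | Hexadecimal.Dd h => [:: true, true, false, true & hex_bits h]
  | Hexadecimal.De h => [:: true, true, true, false & hex_bits h]
  | Hexadecimal.Df h => [:: true, true, true, true & hex_bits h]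
  end.

Fixpoint read_colours k c e (bs : seq bool) : seq nat * seq bool :=
  if k is k.+1 then
    if eqn c e then let: (o, bs) := read_colours k c.+1 e bs in (3 :: o, bs)
    else if bs is [:: b1, b0 & bs] then
      let: (o, bs) := read_colours k c.+1 e bs in ((if b1 then 2 else if b0 then 1 else 0) :: o, bs)
    else ([::], bs)
  else ([::], bs).

Definition other_colours a := match a with 0 => (1, 2) | 1 => (0, 2) | _ => (0, 1) end.

(** Recognises the ends of the marked edge, which either consume the mark or start the edge [e]. No
    colour is forced there, so all of them are read from the bits. *)
Definition free_vertex (h : seq nat) c m e :=
  if has (eqn 3) h then true else if Nat.leb c e then Nat.leb e.+1 (c + m) else false.

(* A colouring with edge [e] marked, in which only the binary choices at the
   vertices with one consumed edge, and all colours at a vertex of [e], are stored. *)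
Fixpoint decode w (f : seq nat) c e (bs : seq bool) : seq nat :=
  match w with
  | [::] => [::]
  | V j :: w =>
      let h := take j f in
      let: (o, bs') :=
        if free_vertex h c (3 - j) e then read_colours (3 - j) c e bs else
        match h with
        | [:: a] => let: (x, y) := other_colours a in
            if bs is b :: bs then (if b then [:: y; x] else [:: x; y], bs) else ([::], bs)
        | [:: a; b] => ([:: 3 - a - b], bs)
        | [::] => read_colours (3 - j) c e bs
        | _ => ([::], bs)
        end in
      o ++ decode w (o ++ drop j f) (c + (3 - j)) e bs'
  | P i :: w => decode w (pull i f) c e bs
  end.

Fixpoint read_colours4 k (bs : seq bool) : seq nat :=
  if k is k.+1 then
    if bs is [:: b1, b0 & bs] then
      (if b1 then if b0 then 3 else 2 else if b0 then 1 else 0) :: read_colours4 k bs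
    else [::]
  else [::].

Section Certificates.
Variables (w1 y w2 : word).

Fixpoint marks_check e hs :=
  if hs is h :: hs then
    if mark_check w1 y w2 e (decode (w1 ++ y ++ y ++ w2) [::] 0 e (hex_bits h))
    then marks_check e.+1 hs else false
  else true.

Definition marks_ok hs :=
  if eqn (size hs) (nids w1 + nids (y ++ y) + nids w2) then marks_check 0 hs else false.

(** Nothing needs to be known about [decode]: [mark_check] tests whatever stream it returns. *)
Lemma marks_exist hs e : marks_ok hs -> e < nids w1 + nids (y ++ y) + nids w2 ->
  exists cs, mark_check w1 y w2 e cs.
Proof.
have chk e0 i (l : seq Hexadecimal.uint) : marks_check e0 l -> i < size l ->
    exists cs, mark_check w1 y w2 (e0 + i) cs.
  elim: l e0 i => [|h l IH] e0 i //=; case: ifP => // ok1 ok2.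
  case: i => [_|i]; last by rewrite ltnS -addSnnS; apply: IH.
  by exists (decode (w1 ++ y ++ y ++ w2) [::] 0 e0 (hex_bits h)); rewrite addn0.
by rewrite /marks_ok; case: eqnP => // <- ok lt; apply: (chk 0 e hs).
Qed.

Definition four_check h :=
  let m := nids w1 + nids (y ++ y) + nids w2 in
  let cs := read_colours4 m (hex_bits h) in
  [&& size cs == m, all (fun c => Nat.leb c 3) cs
    & stream_check w1 y w2 distinct3 true false cs].

End Certificates.

(** * Flows through poles *)

(** Macros act on bundles of consecutive pending edges, of which only the sizes are recorded.
    [Piece w k outs] turns the first [k] bundles into bundles of sizes [outs]; [Pole] turns a triple
    into a triple. *)
Inductive macro := Move of nat | Piece of word & nat & seq nat | Pole of word.

Fixpoint macro_word ms (g : seq nat) : word :=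
  match ms with
  | [::] => [::]
  | Move i :: ms =>
      let l := nth 0 g i in nseq l (P (sumn (take i g) + l).-1) ++ macro_word ms (pull i g)
  | Piece w k outs :: ms => w ++ macro_word ms (outs ++ drop k g)
  | Pole w :: ms => w ++ macro_word ms (3 :: drop 1 g)
  end.

Fixpoint macros_wf ms (g : seq nat) :=
  match ms with
  | [::] => true
  | Move i :: ms => (i < size g) && macros_wf ms (pull i g)
  | Piece w k outs :: ms =>
      (arity w (sumn (take k g)) == Some (sumn outs)) && macros_wf ms (outs ++ drop k g)
  | Pole w :: ms => (take 1 g == [:: 3]) && macros_wf ms (3 :: drop 1 g)
  end.

(* The colours 0, 1, 2 are read as the three nonzero elements of the Klein group. *)
Definition klein c : bool * bool :=
  match c with 0 => (true, false) | 1 => (false, true) | _ => (true, true) end.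

Definition ksum (l : seq nat) :=
  foldr (fun c s => (addb (klein c).1 s.1, addb (klein c).2 s.2)) (false, false) l.

Definition sum_table w gin gout :=
  undup (flatten [seq undup [seq (map ksum (reshape gin f), map ksum (reshape gout o))
                            | o <- runs distinct3 w f] | f <- tuples (sumn gin)]).

(** An upper bound for the lists of bundle sums that 3-edge-colourings can realise. A pole only
    discards the lists with a zero sum on its triple; its word is not inspected. *)
Fixpoint sum_runs ms (g : seq nat) (S : seq (seq (bool * bool))) :=
  match ms with
  | [::] => S
  | Move i :: ms => sum_runs ms (pull i g) (map (pull i) S)
  | Piece w k outs :: ms =>
      let T := sum_table w (take k g) outs in
      sum_runs ms (outs ++ drop k g)
        (undup (flatten [seq [seq t.2 ++ drop k s | t <- T & t.1 == take k s] | s <- S]))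
  | Pole _ :: ms =>
      sum_runs ms (3 :: drop 1 g) [seq s <- S | head (false, false) s != (false, false)]
  end.

Definition superedge w :=
  (arity w 3 == Some 3) &&
  all (fun f => all (fun o => (ksum o == ksum f) && (ksum f != (false, false))) (runs distinct3 w f))
      (tuples 3).

Arguments superedge : simpl never.

Fixpoint superedges ms : Prop :=
  match ms with
  | [::] => True
  | Pole w :: ms => superedge w /\ superedges ms
  | _ :: ms => superedges ms
  end.

Lemma exec_all ok w f cs g (p : pred nat) :
  all p f -> all p cs -> exec ok w f cs = Some g -> all p g.
Proof.
elim: w f cs => [|[j|i] w IHw] f cs /=; first by move=> pf _ [<-].
  move=> pf pcs; case: ifP => // _; apply: IHw; last by apply/allP=> c /mem_drop; move: c; apply/allP.
  rewrite all_cat; apply/andP; split; apply/allP=> c; first by move/mem_take; move: c; apply/allP.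
  by move/mem_drop; move: c; apply/allP.
by move=> pf; apply: IHw; rewrite (perm_all _ (perm_pull i f)).
Qed.

Lemma size_exec ok w f cs g a : arity w (size f) = Some a -> nids w <= size cs ->
  exec ok w f cs = Some g -> size g = a.
Proof.
elim: w f cs => [|[j|i] w IHw] f cs /=; first by move=> [<-] _ [<-].
  case: ifP => // /andP[jf j3] ar sz; case: ifP => // _; apply: IHw.
    by rewrite size_cat size_drop size_takel // (leq_trans _ sz) ?leq_addr.
  by rewrite size_drop leq_subRL // (leq_trans _ sz) ?leq_addr.
by case: ifP => // _ ar; rewrite add0n; apply: IHw; rewrite size_pull.
Qed.

Lemma nids_pulls n i : nids (nseq n (P i)) = 0.
Proof. by elim: n. Qed.

(** Each pull brings the last remaining edge of the bundle to the front. The index stays the same,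
    as the front grows while the bundle shrinks, and the edges arrive in their original order. *)
Lemma exec_block_pull ok (A B1 B2 C : seq nat) w cs :
  exec ok (nseq (size B1) (P (size A + size B2 + size B1).-1) ++ w) (B2 ++ A ++ B1 ++ C) cs =
  exec ok w (B1 ++ B2 ++ A ++ C) cs.
Proof.
elim/last_ind: B1 B2 => [|B1 x IHB] B2 //=.
rewrite size_rcons /= addnS /=; set n := _ + size B1.
have -> : pull n (B2 ++ A ++ rcons B1 x ++ C) = (x :: B2) ++ A ++ B1 ++ C.
  rewrite /pull; have -> : B2 ++ A ++ rcons B1 x ++ C = (B2 ++ A ++ B1) ++ x :: C.
    by rewrite -cats1 -!catA.
  have sz : size (B2 ++ A ++ B1) = n by rewrite !size_cat addnA addnC (addnC (size B2)) addnC.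
  by rewrite drop_size_cat // take_size_cat //= -!catA.
have -> : n = (size A + size (x :: B2) + size B1).-1 by rewrite /= addnS addSn.
by rewrite IHB -cats1 -catA.
Qed.

(** The step common to [Piece] and [Pole]: by [exec_frame] the word sees only its own bundles, and
    the resulting pending list is again cut into bundles. *)
Lemma piece_sound ms w k outs (L : seq (seq nat)) cs :
    arity w (sumn (take k (shape L))) = Some (sumn outs) ->
    all (fun c => c < 3) (flatten L) -> all (fun c => c < 3) cs ->
    size cs = nids (w ++ macro_word ms (outs ++ drop k (shape L))) ->
    (forall o cs', o \in runs distinct3 w (flatten (take k L)) ->
       let L' := reshape outs o ++ drop k L in
       shape L' = outs ++ drop k (shape L) -> all (fun c => c < 3) (flatten L') ->
       all (fun c => c < 3) cs' -> size cs' = nids (macro_word ms (shape L')) ->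
       exec distinct3 (macro_word ms (shape L')) (flatten L') cs' = None) ->
  exec distinct3 (w ++ macro_word ms (outs ++ drop k (shape L))) (flatten L) cs = None.
Proof.
move=> ar L3 cs3 szcs next.
have LE := cat_take_drop k L; have shE : take k (shape L) = shape (take k L) by rewrite -map_take.
have szf : sumn (take k (shape L)) = size (flatten (take k L)) by rewrite shE size_flatten.
rewrite nids_cat in szcs.
have szt : size (take (nids w) cs) = nids w by rewrite size_takel // szcs leq_addr.
rewrite -[cs](cat_take_drop (nids w)) -[flatten L in LHS](congr1 flatten LE) flatten_cat exec_cat //.
rewrite szf in ar; rewrite (exec_frame _ _ ar) ?szt //.
case ex: exec => [o|] //=.
have take3 (l : seq nat) n : all (fun c => c < 3) l -> all (fun c => c < 3) (take n l).
  by move=> l3; apply/allP=> c /mem_take; move: c; apply/allP.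
have drop3 (l : seq nat) n : all (fun c => c < 3) l -> all (fun c => c < 3) (drop n l).
  by move=> l3; apply/allP=> c /mem_drop; move: c; apply/allP.
move: (L3); rewrite -{1}LE flatten_cat all_cat => /andP[L13 L23].
have o3 := exec_all L13 (take3 _ _ cs3) ex.
have szo := size_exec ar (eq_leq (esym szt)) ex.
have shL' : shape (reshape outs o ++ drop k L) = outs ++ drop k (shape L).
  by rewrite /shape map_cat -/(shape _) reshapeKl ?szo // map_drop.
have flL' : flatten (reshape outs o ++ drop k L) = o ++ flatten (drop k L).
  by rewrite flatten_cat reshapeKr ?szo.
rewrite -flL' -shL'; apply: next => //.
- by apply/runsP; exists (take (nids w) cs); rewrite take3.
- by rewrite flL' all_cat o3.
- exact: drop3.
by rewrite shL' size_drop szcs addKn.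
Qed.

(** Induction along the macros, with the sums of the actual bundles kept inside [S]; an empty final
    set leaves no colouring. Poles enter only through [superedge], which preserves the sum and makes
    it nonzero. *)
Lemma sum_runs_sound ms (L : seq (seq nat)) S cs :
    macros_wf ms (shape L) -> superedges ms ->
    all (fun c => c < 3) (flatten L) -> all (fun c => c < 3) cs ->
    size cs = nids (macro_word ms (shape L)) -> map ksum L \in S ->
    sum_runs ms (shape L) S = [::] ->
  exec distinct3 (macro_word ms (shape L)) (flatten L) cs = None.
Proof.
elim: ms L S cs => [|[i|w k outs|w] ms IHms] L S cs /=; first by move=> _ _ _ _ _ + S0; rewrite S0.
- move=> /andP[]; rewrite size_map => iL wf pol L3 cs3 szcs LS S0.
  pose B := nth [::] L i.
  have LE : L = take i L ++ B :: drop i.+1 L by rewrite -drop_nth // cat_take_drop.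
  have pL : pull i L = B :: take i L ++ drop i.+1 L by rewrite /pull (drop_nth [::]).
  have fE : flatten L = [::] ++ flatten (take i L) ++ B ++ flatten (drop i.+1 L).
    by rewrite {1}LE flatten_cat.
  have -> : nth 0 (shape L) i = size B by rewrite (nth_map [::]).
  have -> : sumn (take i (shape L)) = size (flatten (take i L)) + size ([::] : seq nat).
    by rewrite -map_take addn0 size_flatten.
  rewrite {1}fE exec_block_pull /= -map_pull -flatten_cat.
  have fpL : B ++ flatten (take i L ++ drop i.+1 L) = flatten (pull i L) by rewrite pL.
  rewrite fpL; rewrite /shape -map_pull in wf S0 szcs; apply: (IHms _ (map (pull i) S)) => //.
  + rewrite -fpL (perm_all _ (_ : perm_eq _ (flatten L))) // fE /= flatten_cat.
    by rewrite perm_catCA.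
  + by rewrite szcs nids_cat nids_pulls.
  by rewrite map_pull; apply: (map_f (pull i)) LS.
- move=> /andP[/eqP ar wf] pol L3 cs3 szcs LS S0.
  apply: piece_sound => // o cs' oP L' shL' L'3 cs'3 szcs'.
  rewrite -shL' in S0 wf; apply: (IHms L') S0 => //.
  rewrite mem_undup; apply/flatten_mapP; exists (map ksum L) => //.
  have shE : take k (shape L) = shape (take k L) by rewrite -map_take.
  apply/mapP; exists (map ksum (reshape (take k (shape L)) (flatten (take k L))), map ksum (reshape outs o)).
    rewrite mem_filter shE flattenK map_take eqxx /= mem_undup.
    apply/flatten_mapP; exists (flatten (take k L)).
      rewrite mem_tuples size_flatten eqxx; move: L3.
      by rewrite -{1}[L](cat_take_drop k) flatten_cat all_cat => /andP[].
    by rewrite mem_undup; apply/mapP; exists o; last by rewrite flattenK map_take.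
  by rewrite /= -map_drop -map_cat.
move=> /andP[/eqP g3 wf] [/andP[/eqP ar /allP sup] pol] L3 cs3 szcs LS S0.
have eL : exists B L1, L = B :: L1 /\ size B = 3.
  by case: {LS S0 szcs wf L3} L g3 => [|B L1] //=; rewrite take0 => -[szB]; exists B, L1.
case: eL => B [L1 [eL szB]]; rewrite {}eL in g3 wf L3 szcs LS S0 *.
have B3 : all (fun c => c < 3) B by move: L3; rewrite /= all_cat => /andP[].
apply: (@piece_sound ms w 1 [:: 3] (B :: L1)) => //; first by rewrite /= take0 /= szB.
rewrite /= take0 drop0 cats0 => o cs' oP shL' L'3 cs'3 szcs'.
have Bt : B \in tuples 3 by rewrite mem_tuples szB.
have /allP/(_ o oP)/andP[/eqP oB B0] := sup B Bt.
have szo : size o = 3.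
  have /runsP[cs1 [sz1 _ ex]] := oP.
  by rewrite -szB in ar *; apply: size_exec ar (eq_leq (esym sz1)) ex.
have to : take 3 o = o by rewrite take_oversize ?szo.
rewrite to in shL' L'3 szcs' *; apply: (IHms (o :: L1) [seq s <- S | head (false, false) s != (false, false)]) szcs' _ _ => //.
- by rewrite /= szo; move: wf; rewrite /= drop0.
- by rewrite mem_filter /= oB B0.
by move: S0; rewrite /= drop0 szo.
Qed.

Section ChainUncolourable.
Variables (w1 y w2 : word) (F : seq (seq nat)).
Hypothesis start_F : all (fun f => f \in F) (runs distinct3 w1 [::]).
Hypothesis y_F : all (fun f => all (fun g => g \in F) (runs distinct3 y f)) F.

Lemma all_split (p : pred nat) n l : all p l -> all p (take n l) /\ all p (drop n l).
Proof. by rewrite -{1}(cat_take_drop n l) all_cat => /andP. Qed.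

Lemma repeat_frontier k f cs g : f \in F -> size cs = nids (repeat k y) ->
    all (fun c => c < 3) cs -> exec distinct3 (repeat k y) f cs = Some g -> g \in F.
Proof.
elim: k f cs => [|k IHk] f cs fF; first by move=> _ _ [<-].
rewrite repeatS nids_cat => szcs /(all_split (nids y))[take3 drop3].
have szt : size (take (nids y) cs) = nids y by rewrite size_takel // szcs leq_addr.
rewrite -[cs](cat_take_drop (nids y)) exec_cat //.
case ex: exec => [h|] //=; apply: IHk => //; last by rewrite size_drop szcs addKn.
by apply: (allP (allP y_F f fF)); apply/runsP; exists (take (nids y) cs).
Qed.

(** [F] contains the states after [w1] and is closed under [y], so the length of the chain
    disappears; after [w2] only the sums of two triples are remembered. *)
Lemma chain_uncolourable ms S k cs :
    all (fun f => (arity w2 (size f) == Some 6) && all (fun c => c < 3) f) F ->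
    all (fun f => all (fun o => map ksum (reshape [:: 3; 3] o) \in S) (runs distinct3 w2 f)) F ->
    macros_wf ms [:: 3; 3] -> superedges ms -> sum_runs ms [:: 3; 3] S = [::] ->
    let w := w1 ++ repeat k y ++ w2 ++ macro_word ms [:: 3; 3] in
    all (fun c => c < 3) cs -> size cs = nids w ->
  exec distinct3 w [::] cs = None.
Proof.
move=> /allP FP /allP SP wf sup S0 w; rewrite /w {w} !nids_cat => cs3 szcs.
have [a3 cs1_3] := all_split (nids w1) cs3.
have sza : size (take (nids w1) cs) = nids w1 by rewrite size_takel // szcs leq_addr.
have szcs1 : size (drop (nids w1) cs) = nids (repeat k y) + (nids w2 + nids (macro_word ms [:: 3; 3])).
  by rewrite size_drop szcs addKn.
rewrite -[cs](cat_take_drop (nids w1)) exec_cat //.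
case exa: exec => [f|] //=.
have fF : f \in F by apply: (allP start_F); apply/runsP; exists (take (nids w1) cs).
move: (drop _ cs) cs1_3 szcs1 => {cs3 szcs exa sza a3}cs cs3 szcs.
have [b3 cs1_3] := all_split (nids (repeat k y)) cs3.
have szb : size (take (nids (repeat k y)) cs) = nids (repeat k y).
  by rewrite size_takel // szcs leq_addr.
have szcs1 : size (drop (nids (repeat k y)) cs) = nids w2 + nids (macro_word ms [:: 3; 3]).
  by rewrite size_drop szcs addKn.
rewrite -[cs](cat_take_drop (nids (repeat k y))) exec_cat //.
case exb: exec => [g|] //=.
have gF := repeat_frontier fF szb b3 exb.
move: (drop _ cs) cs1_3 szcs1 => {cs3 szcs exb szb b3}cs cs3 szcs.
have [c3 cs1_3] := all_split (nids w2) cs3.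
have szc : size (take (nids w2) cs) = nids w2 by rewrite size_takel // szcs leq_addr.
rewrite -[cs](cat_take_drop (nids w2)) exec_cat //.
case exc: exec => [o|] //=.
have oR : o \in runs distinct3 w2 g by apply/runsP; exists (take (nids w2) cs).
have /andP[/eqP ar2 g3] := FP g gF.
have szo : size o = 6 := size_exec ar2 (eq_leq (esym szc)) exc.
have o3 := exec_all g3 c3 exc.
have sh : shape (reshape [:: 3; 3] o) = [:: 3; 3] by rewrite reshapeKl ?szo.
have fl : flatten (reshape [:: 3; 3] o) = o by rewrite reshapeKr ?szo.
rewrite -{1}fl -{1}sh; apply: (sum_runs_sound (S := S)); rewrite ?sh ?fl //.
  by rewrite size_drop szcs addKn.
by apply: (allP (SP g gF)).
Qed.

End ChainUncolourable.

(** * The graphs *)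

(** The vertices of [a] are built last, and the word before them is already uncolourable. The first
    two vertices of [a] are therefore a pair whose removal does not make the graph
    3-edge-colourable. *)
Lemma chain_graph w1 y b a inv r k hs h :
    arity w1 0 = Some r -> arity y r = Some r -> arity (b ++ a) r = Some 0 -> 1 < nverts a ->
    expansion_check w1 y (b ++ a) inv ->
    (forall cs, all (fun c => c < 3) cs -> size cs = nids (w1 ++ repeat k y ++ b) ->
       exec distinct3 (w1 ++ repeat k y ++ b) [::] cs = None) ->
    marks_ok w1 y (b ++ a) hs -> four_check w1 y (b ++ a) h ->
    1 < k -> 0 < nids y -> 3 < nverts y ->
  exists G : sgraph, [/\ #|G| = nverts (w1 ++ repeat k y ++ b ++ a), snark G, strictly_critical G
                       & cyclically_connected G 6].
Proof.
move=> ar1 ary ar2 a2 chk unc marks four k2 y0 y4.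
pose w := w1 ++ repeat k y ++ b ++ a.
have closed : arity w 0 == Some 0.
  by rewrite arity_cat ar1 /= arity_cat (arity_repeat _ ary) /= ar2.
pose s := @src w; pose d := dst closed.
have deg := word_deg3 closed.
have n7 : 7 < nverts w.
  rewrite /w !nverts_cat nverts_repeat addnCA (leq_trans _ (leq_addr _ _)) //.
  by rewrite (@leq_mul 2 4).
have expand (A : {set 'I_(nverts w)}) : 0 < #|A| -> 0 < #|~: A| -> minn (minn #|A| #|~: A|) 4 + 2 <= #|boundary s d A|.
  have cnt (B : {set 'I_(nverts w)}) : count (joined B) (iota 0 (nverts w)) = #|B|.
    rewrite -{1}[nverts w]subn0 -/(index_iota 0 _) -sum1_count big_mkord -sum1_card.
    by apply: eq_bigl => x; rewrite joined_ord.
  have cntC : count (fun x => ~~ joined A x) (iota 0 (nverts w)) = #|~: A|.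
    rewrite -cnt; apply: eq_in_count => x; rewrite mem_iota => /andP[_ xn].
    by rewrite -[x]/(val (Ordinal xn)) !joined_ord inE.
  move=> A0 A0'; have := expansion (k := k) (s := joined A) ar1 ary ar2 chk.
  by rewrite /= -/w cntC cnt cost_boundary [minn #|~: A| _]minnC; apply.
have nw : nverts w = nverts (w1 ++ repeat k y ++ b) + nverts a.
  by rewrite /w !nverts_cat !addnA.
have xlt i : i < 2 -> nverts (w1 ++ repeat k y ++ b) + i < nverts w.
  by move=> i2; rewrite nw ltn_add2l (leq_trans i2).
pose u := Ordinal (xlt 0 isT); pose v := Ordinal (xlt 1 isT).
have [sn sc] : snark (mgraph s d) /\ strictly_critical (mgraph s d).
  apply: (mg_strictly_critical deg n7 expand (u := u) (v := v)).
  - by rewrite -val_eqE /= addn0 addn1 neq_ltn leqnn.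
  - apply: (uncolourable_of_prefix (w1 := w1 ++ repeat k y ++ b) (w2 := a)); last exact: unc.
    + by rewrite /w -!catA.
    + exact: leq_addr.
    exact: leq_addr.
  - move=> e; have [cs [sz cs4 ne cnt ex]] :=
      marked_streams y0 k2 (fun e' => marks_exist marks (e := e')) (ltn_ord e).
    apply: (critical_of_stream closed sz cs4 _ ex) => f.
    apply/eqP/eqP=> [nf|->//]; apply: val_inj.
    by apply: (nth_count1 cnt) => //; rewrite sz ltn_ord.
  have /and3P[/eqP sz cs3 chk4] := four.
  have [cs [szcs cs4 ex]] := four_streams k2 sz cs3 chk4.
  exact: (four_colouring_of_stream closed szcs cs4 ex).
exists (mgraph s d); split=> //; first by rewrite card_ord.
exact: (mg_cyclically_connected deg n7 expand).
Qed.

(** One block of a flower snark: a centre with three neighbours, all six outer edges pending. The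
    final pulls put the edges to the next block first and those to the previous block last, both in
    the same order of the neighbours. *)
Definition start : word :=
  [:: V 0; V 1; P 2; V 1; P 4; V 1; P 1; P 3; P 5; P 3; P 4; P 5].

(** Attaches a claw, with [V 3] as its centre, to the first three pending edges and leaves its
    outgoing edges in the corresponding order, so that copies can be chained directly. *)
Definition block : word :=
  [:: V 1; P 2; V 1; P 4; V 1; P 4; P 3; V 3; P 1; P 2].

Definition param_rest : word :=
  [:: V 1; V 1; P 4; P 2; V 2; P 3; P 2; V 2; V 1; P 3; V 1; P 2; V 2; P 3; V 2; V 1; P 5;
      P 2; V 2; V 1; P 5; V 2; P 4; V 1; P 4; V 2; P 3; P 3; P 4; P 3].

Definition pole : word :=
  [:: V 1; P 2; V 1; P 2; V 1; V 1; P 3; V 2; P 4; V 1; P 2; V 2; P 2; V 1; P 2; V 1; P 2;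
      V 2; P 5; V 2; P 4; V 1; P 3; P 2; V 2; V 1; P 4; P 2; V 2; P 3; P 2; V 2; P 4; V 2;
      P 2; V 2].

(** Three superedges meet at h3, and one bypass edge joins the pole on h3 h4 directly to the pole on
    h3 l0. The triple of this pole at h3 thus consists of two incoming edges and one outgoing edge,
    which is why it is run as part of a [Piece] and not as a [Pole]. *)
Definition pole2 : word :=
  [:: V 1; P 2; V 1; P 3; V 1; P 3; P 2; V 2; V 1; P 2; V 1; P 2; V 1; P 2; V 2; V 1; P 6;
      V 2; V 1; P 4; V 2; P 4; V 2; P 4; V 1; P 2; V 2; P 3; V 2; P 2; V 1; P 2; V 2; P 1;
      P 3; P 3].

Definition star_pole : word :=
  [:: P 2; V 1; V 1; P 4; V 1; V 1; P 4; V 2; V 1; V 1; P 4; V 2; V 1; P 5; P 2; V 2; P 1;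
      V 1; P 4; V 2; P 6; V 2; P 2; V 2; P 2; V 1; P 1; V 1; V 1; P 7; V 2; P 3; V 1; P 2;
      V 2; P 2; V 1; P 6; V 2; P 2; V 2; V 1; P 6; V 2; P 2; V 2; P 3; P 2; V 2; P 2; P 2;
      V 2; P 2].

(** The three vertices that replace h0, each taking one edge from each of the three triples that end
    there. They come last so that the word before them is the graph without them. *)
Definition apex : word :=
  [:: P 6; P 4; V 3; P 4; P 3; V 3; V 3].

(* After [start], a chain of blocks and [param_rest], which form the pole on h1 h2,
   the poles are those on h0 h1, h2 h3, h3 h4 (with the vertex h3), h3 l0, l0 h0,
   h4 h5 and h5 h0. *)
Definition pieces (e0 e2 e5 : word) : seq macro :=
  [:: Move 1; Piece [:: V 1] 1 [:: 1; 3]; Move 1; Pole e0;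
      Move 1; Piece [:: V 1] 1 [:: 1; 1];
      Move 1; Piece [:: V 1] 1 [:: 1; 1];
      Move 1; Piece [:: V 1] 1 [:: 1; 1];
      Move 5; Move 1; Piece [:: V 2] 2 [:: 3]; Pole e2;
      Piece (V 1 :: P 2 :: pole2) 1 [:: 3; 3]; Move 1; Pole pole;
      Move 3; Piece [:: V 2] 2 [:: 3]; Pole pole;
      Move 1; Move 3; Piece [:: V 2] 2 [:: 3]; Pole pole;
      Move 2; Piece [:: V 2] 2 [:: 3]; Pole e5; Move 1; Move 2].

(** [j] counts the poles from the double-star snark; they are placed on h0 h1, h5 h0 and h2 h3, in
    this order. *)
Definition variant_pieces j :=
  pieces (if 0 < j then star_pole else pole) (if 2 < j then star_pole else pole)
         (if 1 < j then star_pole else pole).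

(** Blocks are added in pairs because a flower snark has an odd number of them. *)
Definition double_block := block ++ block.
Definition body j := param_rest ++ macro_word (variant_pieces j) [:: 3; 3].
Definition closing j := body j ++ apex.

(* Hexadecimal literals serve as bit strings. *)
Definition hex_of_num (u : Number.uint) : option Hexadecimal.uint :=
  if u is Number.UIntHexadecimal h then Some h else None.
Definition num_of_hex (h : Hexadecimal.uint) : option Number.uint :=
  Some (Number.UIntHexadecimal h).
Declare Scope hex_scope.
Delimit Scope hex_scope with hex.
Number Notation Hexadecimal.uint hex_of_num num_of_hex : hex_scope.

(** * Certificate colourings for the four values of [j] *)

Definition marks0 : seq Hexadecimal.uint :=
  [:: 0x005164282e4ca028570c16de8; 0x005a69482e02e2740b0c32dd4; 0x04196400ec0ed2100a2331d1c;
      0x1802458905c0ec4e8161865ba8; 0x18532c781b01d89d0288ccb07; 0x18a054c105c0da420161867ba8;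
      0x18934d941183b484028b4c675; 0x19a52c850ec88c050ae182dbd0; 0x189a69861883b484028b4c675;
      0x18ba6960ec02e2740a2332c1c; 0x18b52c841d80da420144663a38; 0x184a64282e446028570c16de8;
      0x18428c8505c88c050ae182dbd0; 0x186164282e446028570c16de8; 0x18414c8505c88c050ae182dbd0;
      0x181864282e446028570c16de8; 0x181a0c8505c88c050ae182dbd0; 0x1814a4282e446028570c16de8;
      0x181c848505c88c050ae182dbd0; 0x1822a4282e446028570c16de8; 0x182ac08505c88c050ae182dbd0;
      0x181a69282e446028570c16de8; 0x181a540505c88c050ae182dbd0; 0x181729282e446028570c16de8;
      0x18170a0505c88c050ae182dbd0; 0x181784282e446028570c16de8; 0x1817052505c88c050ae182dbd0;
      0x181661282e446028570c16de8; 0x1816682505c88c050ae182dbd0; 0x181652282e446028570c16de8;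
      0x1816720a0b91180a15c305b7a; 0x18168a282e446028570c16de8; 0x1816ab0a0b91180a15c305b7a;
      0x1816694905c1da420161867ba8; 0x1816695505c88c050ae182dbd0; 0x18165e120b83b48402c30cf75;
      0x18165e0a0b91180a15c305b7a; 0x18165e4417036908058619eea; 0x18165d4a0b91180a15c305b7a;
      0x181659020b83b48402c30cf75; 0x1816596005c05c4e8161865ba8; 0x181658820b81b48402c30cf75;
      0x18165980468ad604014f463a38; 0x18165a4417076908058619eea; 0x18165a820b80b89d02c30cb75;
      0x1816588c0b80b89d02c30cb75; 0x181659141183b484028b4c675; 0x181658801180b89d028b4ca75;
      0x181658c81181d89d028b4ca75; 0x1932c81005c1da420161867ba8; 0x19b2c836641ad17a2d11994ea;
      0x181659440b83b48402c30cf75; 0x181658c80888146c0acee45838; 0x181658dddbc052146b3398c56;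
      0x19b2c933a418144e994562b860; 0x1932c8080d885c4e815262b860; 0x1932c8740e09d8030220e2dbd0;
      0x18165bc968485c4e814462b498; 0x1932c870d093b006040ac5a77; 0x1932cd0a2cc118170b8202f61;
      0x1a1659af0048f04e814462b498; 0x181658cf1288f04e8145a2b490; 0x1a165af05b9028d815c0c8b75;
      0x1a1659698a08d8030220e2d3b8; 0x1a1659aa0223c13a05498ae18; 0x1932c855141158d815c0c8b75;
      0x1932c99134f8fda3d855b416c; 0x1932c9956a92380a119d45b0c; 0x1932c9978012380a118ac5a76;
      0x1a165af7591028d8159d89623; 0x1a1659aaf491e09d0288c57c4; 0x1a16596f0d11b006040ac5a77;
      0x1a16596f0223600c08158b4ee; 0x1932c9b3ee23c13a05118af88; 0x1a16596dd311b0060441c5b7a;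
      0x1932cd0c344118170b8242e10; 0x1a1659af2511e09d028b45692; 0x1932c8701413b006040ac5a77;
      0x1a16596ad511b006045d45b0c; 0x1932c87510e134bd17f5395c0; 0x1a1659aed523c13a05168af88;
      0x1932c8767027600c083a8b618; 0x1932cd08432cb69f24c735828; 0x19b2c8115c30b5ed996c07809;
      0x1a1659b22808f25e014c6653a8; 0x181658c08d12074f344140a7a; 0x18165bc2c9505c4e99a9a65328;
      0x1a1659b2285028d81598c8a75; 0x1932c844eb3d03eccef82a945; 0x19b2c814b3a9b817335d82e13;
      0x1932cd185f9a040318c8e2de20; 0x1932cd13c7840c0b99a9a17040; 0x1932cd1f14a6b80d0288c4675;
      0x1a1659d87bc6a806329945bc4; 0x19b2cf14a1f5544e820cc17098; 0x1a1659d43bf62c0d194ca17080;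
      0x19b2cf14a3809817335d82e13; 0x19b2cf14a398a00d194cc17098; 0x1932cd1f17a5521436228b524;
      0x1932cd185cac08041698c5bc4; 0x19b2c8115e7139aaea5102e09; 0x1932cd185cf808081698c5bc4;
      0x19b2cf14a1dcc00a3b0ec5a63; 0x1a1659dbe091a004158b45b0c; 0x1932cd1f17b2cc17329948e36;
      0x1932cd13c5d928081699cce2b; 0x1932cd1317ff3814450b84ec2; 0x1932c8624c76e17a2332996d0;
      0x19b2cf1928adb00d02a484707; 0x18165942157a1004169e8c74c; 0x19b2cf115fd8a81a3199a8945;
      0x1932cd131782a11b1684ced45; 0x19b2cf115fdb280a31998ce2b; 0x181658c08e0e5427041d4476d;
      0x19b2cf192bb2d82e653a91c56; 0x1a1659db17dda00c653a98c56; 0x19b2cf14a1b4c0040298c2613;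
      0x1a1659d8797dcd6e05e18d3330; 0x1932c840ac7840b01a9a667ba8; 0x1932c840ec62938532994cd44;
      0x19b2c810144de80c91ccb053d0; 0x19b2c814a60ae5b011c6c65328; 0x1932cd13c62c68ad0288c116d;
      0x19b2c813312698039d80a2d3d0; 0x19b2c81332197827238ac4675; 0x19b2c81156615c011688c116d;
      0x1932c807526258508b618080b8; 0x1932c80996dd55d61b0148a75; 0x19b2cf115c0df8e6028b4d761;
      0x1932c844e6228d3b3588c4675; 0x1932c844e622955e3588cca75; 0x1a1659d4e934eb650b6f549490;
      0x1932c840efe6b003229941168; 0x1932c840ec628ca632994d761; 0x19b2cf115c0dfb33028b4cd44;
      0x19b2c813320ac71615a48cb6d; 0x19b2c814a60ae467238d81065; 0x1932c840ac7843c28b4c6473a8;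
      0x19b2c813321972ac4715914ea; 0x1932c840efe697383622996d0; 0x19b2c813321955a8119d48b6d;
      0x19b2c814a60ae4e68e3685667; 0x19b2cf115c0dfb3805169aec2; 0x1932c8099519ba0a17081da52;
      0x1a1659d4e934e9141e0405b6f; 0x19b2c813320adab275e866217; 0x1932c807526268b522c30ca17;
      0x1932c8099743605354c2063a38; 0x1932c840edf17fd9d448e05b08; 0x19b2c814b331969a8f0248a75;
      0x19b2c811566165b8f1c0c2e08; 0x1932c80997436bd22f82057828; 0x1932c8075371369235618470b8;
      0x1816594214e10033a25105a77; 0x19b2c81332197f91ab46d44a28; 0x19b2c8115f6695b80316916d0;
      0x19b2c8115661709e01c0c7808; 0x19b2c81156617098d68a88a2b; 0x1932c840ec628bf3a05129663;
      0x1932c8075262689a2105cec45; 0x1932c80996dd5697c90b48e36; 0x1932c8075262689e110ecec45;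
      0x1932cd13c62c5baeca5347808; 0x1932c807537129752a8698e6e; 0x19b2c814a7753934012298cea;
      0x1a1659d43ad2f35a6a8d80a23; 0x1932c840ecf27f33c1c105a63; 0x19b2c814a7753933e0020c675;
      0x1932c8075262689dbc8ecec45; 0x181658c08cf4bb10e09d85703; 0x1a1659d87afd87ddd20d80b0c;
      0x1a1659d43ad2f35a561b01446; 0x1932c8075262689dea0b9d88a; 0x181658c08cf4bb10e82a8ae06;
      0x19b2cf15d82160cfdd4dc8b07; 0x1932c840efe68c60b084c13040; 0x1932c840edf1568dea4a83c860;
      0x1932c840efe68c60b37182608; 0x19b2cf15d82160cfd834c8b07; 0x1932c840efe68c60b380213040;
      0x181658c0b5a57a9622a6a3b080; 0x1932c840edf17fc997b187808; 0x1932c840edf17fc994ca23c860;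
      0x1932c840edf1568de8c28f010; 0x19b2cf15d82146ceea4548b07; 0x19b2cf15d82146ceea052ab14;
      0x1932c840edf1568de9d507808; 0x19b2cf15d82160cfd936c8b07; 0x1932c840efe68c60b2c702608;
      0x19b2cf15d82160cfd9204ab28; 0x19b2cf15d82160cfd874cab28; 0x19b2cf15d82160cfd87c95650;
      0x19b2cf15d82160cfd8671160e; 0x19b2cf15d82160cfd86d88b07; 0x19b2cf15d82160cfd9254ab28;
      0x19b2cf15d82146cee9f00ab28; 0x19b2cf15d82160cfd9200ab28; 0x19b2cf15d82160cfd92548b07;
      0x1932c840edf1568debe447838; 0x19b2cf15d82146cee9f615650; 0x1932c840edf17fc994d50f218;
      0x1a1659b229b1c4c2ce75c95c0; 0x181658c08cf24bcee9f00694d; 0x1932c844e785ea43ccf4553118;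
      0x181658c08cf2789e161d1083b0; 0x19b2c814a775393b1bb8a3210; 0x1932c844e785ea43ccf565465;
      0x1932c801971a8d58b789553498; 0x19b2c814a775393b1bb80e0080; 0x19b2c814a775393b1bb900255;
      0x181658c08cf2789e161c9841b0; 0x19b2c814a775393b1bb9468ea; 0x1932c844e785ea43ccf5ca94c;
      0x1932cd13c62c7930e310b5339; 0x19b2c814a775393b1bb912e92; 0x1932c844e785ea43ccf418f0c;
      0x19b2c814a775393b1bb9f2492; 0x1932c844e785ea43ccf524665; 0x1932c844e785ea43ccf565665;
      0x1932c844e785ea43ccf41a218; 0x1932c844e785ea43ccf50a0ca; 0x181659424de507608ed006938;
      0x1932c840edbc5a1894d58a465; 0x1932c844e785ea43ccf41d50c; 0x19b2c814a775393b1bb9bac92;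
      0x1932c844e785ea43ccf5d430c; 0x1a1659d43ad2f35627f5c62b3; 0x181658c08cf2789e161cfb06c;
      0x181658c08cf2789e161cf38ec; 0x1932c844e785ea43ccf505618; 0x19b2cf15d82168bd17550e533;
      0x1932cd13c62c79311732892128; 0x19b2cf15d82168bd1755e85028; 0x1932cd13c62c7930e311a53af;
      0x1932c805d432009c319139459; 0x19b2cf15d82168bd1751e845f0; 0x1932cd13c62c7931173289e158;
      0x1a1659d43ad2f35627f53a095; 0x19b2cf15d82168bd17503b0c08; 0x19b2cf15d82168bd1751e83b6;
      0x1932cd13c62c7930e311a5e57; 0x181658c08e0e003430d62df44; 0x1932c840d8a6b979573300e6a;
      0x19b2cf15d82168bd1755e8780; 0x1932c87dd5e6bf662975fa454; 0x19b2cf15d82168bd17503b3c9;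
      0x19b2cf15d82168bd17503b6c4; 0x1932cd13c62c7930e3108936a; 0x19b2cf15d82168bd1751e87da;
      0x1932cd13c62c7930e311a5154; 0x1a1659d43ad2f35625a61ef84; 0x19b2cf15d82168bd1755e80ea;
      0x19b2cf15d82168bd1755e80f9; 0x1932cd13c62c7930e31089326; 0x19b2cf15d82168bd15ac65968;
      0x1932cd13c62c7930e311a5154; 0x1a1659d43ad2f35627f5c42d4; 0x181658c08e0e00dc147128828]%hex.

Definition marks1 : seq Hexadecimal.uint :=
  [:: 0x005164282d62650142b498b618; 0x005a69482d601713a054999a98; 0x04196400006076908051198e8e;
      0x1802458905ac0762740a9333530; 0x18532c7800180ec4e8144665838; 0x18a054c105ac06d2100a9331d30;
      0x18934d9402181da420144663b68; 0x19a52c8515a4446028569316c30; 0x189a6960001848e028477516c30;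
      0x18ba696000601713a05119960e; 0x18b52c84000c06d2100a2331d1c; 0x184a64282d62230142b498b618;
      0x18428c8505ac446028569316c30; 0x186164282d62230142b498b618; 0x18414c8505ac446028569316c30;
      0x181864282d62230142b498b618; 0x181a0c8505ac446028569316c30; 0x1814a4282d62230142b498b618;
      0x181c848505ac446028569316c30; 0x1822a4282d62230142b498b618; 0x182ac08505ac446028569316c30;
      0x181a69282d62230142b498b618; 0x181a540505ac446028569316c30; 0x181729282d62230142b498b618;
      0x18170a0505ac446028569316c30; 0x181784282d62230142b498b618; 0x1817052505ac446028569316c30;
      0x181661282d62230142b498b618; 0x1816682505ac446028569316c30; 0x181652282d62230142b498b618;
      0x1816720a0b5888c050ad262d860; 0x18168a282d62230142b498b618; 0x1816ab0a0b5888c050ad262d860;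
      0x1816694905ac0ed2100a9331d30; 0x1816695505ac446028569316c30; 0x18165e120b581da420152663a60;
      0x18165e0a0b5888c050ad262d860; 0x18165e4416b01b48402a4cc74c; 0x18165d4a0b5888c050ad262d860;
      0x181659020b581da420152663a60; 0x1816596005ac02e2740a9333530; 0x181658820b580da420152663a60;
      0x18165aaa96b554b020760831d1c; 0x18165a4416b03b48402a4cc74c; 0x18165a820b5805c4e8152666a60;
      0x1816588c0b5805c4e8152666a60; 0x1816591402181da420144663b68; 0x18165880021805c4e8144665b68;
      0x181658c802180ec4e8144665b68; 0x1932c81005080ed2100a2331d1c; 0x1932cd213ac27480811c34c737;
      0x181659440b581da420152663a60; 0x1816594252b840a36056762588c; 0x181658d800c01e09d0288ccb6d;
      0x19b2cf189bf0847021a605319d4; 0x19b2cf1a402608c05194cc2db78; 0x181658ca04204782740a2d15a48;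
      0x1932c85227188ac6c0ae0645ba8; 0x1932c9969a0091c0508e0e2dbd0; 0x1932c87680009d8030220e2dbd0;
      0x181658c904004782740a2d15f10; 0x1a16596f5a048d803020562d3b0; 0x1932c85450008ac6c0ae0645ba8;
      0x1a1659aa23048f04e8145a2be20; 0x181658c8ac488f04e815262b860; 0x1a16596d8a0246c018102b169d8;
      0x1932c996a83491c0508cea2d860; 0x1932c9b209108f04e8145a2be20; 0x181658c862884782740a2d15f10;
      0x1a16596b41508d803020ea2d860; 0x1a165af5550040a360570322dd4; 0x1932c9b04b588f04e815262b860;
      0x1932c991ca212380a11dd45b0c; 0x1a165af525008146c0ae0645ba8; 0x1932c9b05bc88f04e814462be20;
      0x1a165af7e419028d8158b49637; 0x1932c994e2192380a118ac5a77; 0x1a1659a817aa9d1a1e7949d4e8;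
      0x18165bcea28242e2740a2315f10; 0x1932c9b568044782740a9315c30; 0x1a165af1dc0440a36056762588c;
      0x1932c997ac7091c0508e0e2dbd0; 0x1932c9b1974c8f04e814462b498; 0x18165bcab02a42e2740a2315a4c;
      0x1932c9935dd92380a11c1c5b7a; 0x1932c9954d5891c0508eea2d860; 0x1932c997a92491c0508e0e2dbd0;
      0x1a165af1ded9028d8158b48a75; 0x1932cd0e205208c0b85c1217b08; 0x1932c9935cc891c0508e0e2dbd0;
      0x1932c9b568111e09d028b457c4; 0x1932c9935c4091c0508e0e2d3b8; 0x18165bcab65485c4e814462b498;
      0x1932c9b193a08f04e814462be20; 0x1932c9b193911e09d0288c5693; 0x1932c99358e92380a11c1c5b7a;
      0x1932c995480e8e4297455dc078; 0x1a165af1de44aa65e4b399be14; 0x19b2c91fedf1e125d3af4067158;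
      0x1a1659d60de00762740a9232db4; 0x19b2c91fea521713b3721817098; 0x19b2c81d315142f46c0a2d3b114;
      0x1a1659d60de2114050ad242db78; 0x19b2c81eede2c605885e198d158; 0x19b2c81eedfd4dc051d80a2de20;
      0x1a165962bffd542068c6660b84c; 0x1932c87d40160a80182f61168b4; 0x1a165967f9ff0d00d194ca17080;
      0x18165bc7a52834e04014f463a60; 0x19b2cf19443d6aa4286c0516c30; 0x1a1659d60dffb54068ca170bd84;
      0x1932c87ccf65d10020b4c62d490; 0x19b2cf14f5ed10227410170bd84; 0x1932cd19f4ff0100631d1c5a92;
      0x18165bc7a528518020acf463a60; 0x1932cd19f4f95b776634ea76948; 0x1a1659d60def9a8040b42613b08;
      0x1932c87c8525e60068152423838; 0x19b2c93cedf0c50020b4c667158; 0x1932c87ccf7735a0485c10083a8;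
      0x1932c87d40067245e08e1a65ba8; 0x1a165962bfecda0041598c2613; 0x19b2c93cedf2630041598cce2b;
      0x1a1659d7b1bfa108d8b4ce761a0; 0x1932c87d40061c8040b45a2de20; 0x18165bc7a53bb148d8b4f476940;
      0x19b2cf14f5fe4900d18c2e17b08; 0x18165bc7a539a58850d8ae63b40; 0x1932c86294a189a13914ea2db78;
      0x1932c87ccf74d4006098205a76; 0x1932c87ccf77e70060b8205a76; 0x1932c87d40061c04e914562be20;
      0x1a1659d7b1aa8b00642608829e8; 0x1a1659ba93da8a1300c665329d4; 0x19b2c93d2a5cd43230b4266b318;
      0x1932c84296b0ca74705a63229d4; 0x19b2c93cedee0a9f50c666a2514; 0x19b2c81d34b5e34569d80a083a8;
      0x19b2c91fedef899a85a6053b514; 0x1a1659b60de33855788cea2db78; 0x19b2c81d315675a018f01008838;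
      0x19b2c81d315675f158780832c1c; 0x19b2c91fea4eda2fb18e983b098; 0x1932c84290b18b437114ca65b68;
      0x19b2c81d34b5e3c011d80a233a8; 0x1a1659ba93cc9552c994ca761a0; 0x19b2c81d315675e974e65552ce4;
      0x19b2c93cedee0a31498ccc76028; 0x19b2c81d315675c5b0f01065838; 0x1932c87d400e6fd999945676a28;
      0x19b2c8152a40f5de081618470b8; 0x1932c87c852f14a6298e8e17080; 0x1a165962bfea0139007609829e8;
      0x1932c84296b0cb3a3229941075; 0x19b2c91fedef8a481338ac6d45; 0x1a165962bfea013910ec126b3d0;
      0x1932c84296b056668c578c2b338; 0x1a1659d33289e7e1b1e4305a7a; 0x1a1659b60de3c3ac5329d4cd4d;
      0x19b2c8152a4ba850b0d80a2d998; 0x1932cd19f4f06f84cf21a671828; 0x1a1659d33297b58494dcec47328;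
      0x1a1659b60de339f922ae3631d1c; 0x19b2cf194438461ac6b6233b4a4; 0x19b2c8152a578806ce842e05860;
      0x1932cd19f4f06ee310a85a13080; 0x1a1659d7b1bbc350917c08319d4; 0x1a1659d3329bc201946b0c319d4;
      0x1932cd19f4f962069ca92457828; 0x1932cd19f4f06ee54c51470b840; 0x1932cd19f4f06fdcab48b42e10;
      0x1a1659d60dfba6e19a94ea63b68; 0x19b2c91fedf056a75291623cb08; 0x1932cd19f4f06f84e4acd63c080;
      0x1a1659d33297df9ace1c6c05860; 0x1a1659d60dfbb454ee282045b68; 0x1932cd19f4f06ee54d628e17080;
      0x19b2c8152a5788e5f8a8762b860; 0x1a1659d60dfbb454c03a488b6d; 0x19b2c91fea5acbbd5fe84cab28;
      0x1932c87c853cf5c9a0c4aa2d818; 0x1932cd19f4f06fdca1c8d617080; 0x1932c87c853cf5c9a0a8aa2d818;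
      0x1a1659d33297df9ace84ec05860; 0x19b2c91fea5057cbf39298361d8; 0x1932c87d400e6fc21a8a9223b40;
      0x19b2c91fea5acb257911eccd4c; 0x1a1659b60de339f93d8d2cc776; 0x1a1659d60dfbb454edf0b48a75;
      0x1a1659d7b1aa979e59406c552b8; 0x1932c84290bd8b29b3200c09824; 0x1a1659d7b1aa979e58a60522dd4;
      0x1a1659ba93cc9589a73a382d318; 0x19b2c8152a40f4ba3681a665838; 0x1932c87d400e6fc212f55011db4;
      0x1932c84290bd8b29b32a4b09c30; 0x19b2c8152a4b8bfe58b52a45838; 0x19b2c817aba18bdd5e668422dd4;
      0x19b2c817aba18bdd5e65a08b75; 0x1a1659d7b1aa979e58b888552b8; 0x1932c87d400e6fc212f662282e;
      0x1a1659d7b1aa979e58ae80552b8; 0x19b2c817aba18b456d1db266ba8; 0x19b2c817aba18b456d08a866ba8;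
      0x19b2c817aba18b457a5fb066ba8; 0x1a1659ba93cc9589a7370a2d318; 0x1932c87d400e6fc212e250476d;
      0x1a1659ba93cc9589a73f585a63; 0x19b2c817aba18b457a4f5c65ba8; 0x19b2c8152a40f4ba36892a66a60;
      0x19b2c817aba18bdd5e634045ba8; 0x19b2c8152a40f4ba36890066a60; 0x1932c87d400e6fc21902b023b68;
      0x1932c84290bd8b29b3262e3f0c; 0x1a1659ba93cc9589a73b545a63; 0x1a1659ba93cc958992ffa85b33;
      0x1a1659ba93cc9589a72105d31c; 0x1932cd19f4f9633466b0503b490; 0x19b2c8152a5788e51ac050ba95c;
      0x1a1659d7b1aa8bd0cb6368d2914; 0x19b2c81d31521c532f539315860; 0x1932c84290bd8b29cca65525168;
      0x19b2c81d31521c532f538500d1c; 0x1a1659d7b1aa8bd0c8a650ba1d4; 0x19b2c81d31521c532f538c43358;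
      0x1a1659d33289e7dc90bbab56f10; 0x19b2c81d31521c532f5382ab05; 0x19b2c8152a5788e51ac05c442b8;
      0x19b2c81d31521c532f44578e728; 0x1a1659d7b1aa8bd0c8a65e403a8; 0x19b2c81d31521c532f538843358;
      0x19b2c8152a5788e51accc04c0b8; 0x1a1659d7b1aa8bd0c8a65c663a8; 0x1a1659d7b1aa8bd0cb636624228;
      0x19b2c8152a5788e51ac0537057; 0x19b2c81d31521c532f53967023; 0x1a1659d7b1aa8bd0c8a656292a8;
      0x19b2c81d31521c532f538621a38; 0x19b2c8152a5788e51accc03a0b8; 0x1a1659d7b1aa8bd0c8a65c593a8;
      0x1a1659d7b1aa8bd0c8a65b513a8; 0x1a1659d33289e7dc90bbae94308; 0x1a1659d7b1aa8bd0c8a65b5055;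
      0x19b2c81d31521c532f5388606b; 0x19b2c8152a5788e51acccea03c; 0x1a1659b60de3c23f0c63b7e0228;
      0x1a1659b60de3c23f0c63b7fa584; 0x1a1659b60de3c23f0c63b259684; 0x1a1659b60de3c23f0c7657fa8c8;
      0x1a1659b60de3c23f0c7657faf88; 0x1a1659b60de3c23f0c63b25f004; 0x1a1659b60de3c23f0c7657fa700;
      0x1a1659b60de3c23f0c7657f84e0; 0x1a1659b60de3c23f0c63b25d4a8; 0x1a1659b60de3c23f0c63b25e02;
      0x1a1659b60de3c23f0c63b25ac08; 0x1932c9bd2d798a1cef41eccad0; 0x19b2c91bb09d8d58e9c6398f2a0;
      0x1a1659b60de3c23f0c63b7fc2c8; 0x19b2c81927a8cb5a3d0d3f422a0; 0x1a1659b60de3c23f0c63b7fc000;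
      0x1a1659b60de3c23f0c7657fb620; 0x1a1659b60de3c23f0c63b25c85; 0x1a1659b60de3c23f0c63b25c10;
      0x1a1659b60de3c23f0c63b7fc048; 0x1a1659b60de3c23f0c63b7ffa10; 0x1a1659b60de3c23f0c7657fa500;
      0x1a1659b60de3c23f0c63b25c920; 0x1a1659b60de3c23f0c63b25c2a0; 0x1932c9bd2d798a1cef57aa2d14;
      0x1a1659b60de3c23f0c63b7fc08; 0x1a1659b60de3c23f0c7657fa4d; 0x19b2c817abb7925a05b3acd358]%hex.

Definition marks2 : seq Hexadecimal.uint :=
  [:: 0x005164282d62650142b498b5690; 0x005a69482d601713a05499956bf; 0x04196400006076908051198c014;
      0x1802458905ac0762740a9332ad7e; 0x18532c7800180ec4e81446650050;
      0x18a054c105ac06d2100a9331a17e; 0x18934d9402181da4201446633e1c;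
      0x19a52c8515a4446028569316ad20; 0x189a6960001848e028477516ad20;
      0x18ba696000601713a0511994014; 0x18b52c84000c06d2100a23318028; 0x184a64282d62230142b498b5690;
      0x18428c8505ac446028569316ad20; 0x186164282d62230142b498b5690;
      0x18414c8505ac446028569316ad20; 0x181864282d62230142b498b5690;
      0x181a0c8505ac446028569316ad20; 0x1814a4282d62230142b498b5690;
      0x181c848505ac446028569316ad20; 0x1822a4282d62230142b498b5690;
      0x182ac08505ac446028569316ad20; 0x181a69282d62230142b498b5690;
      0x181a540505ac446028569316ad20; 0x181729282d62230142b498b5690;
      0x18170a0505ac446028569316ad20; 0x181784282d62230142b498b5690;
      0x1817052505ac446028569316ad20; 0x181661282d62230142b498b5690;
      0x1816682505ac446028569316ad20; 0x181652282d62230142b498b5690;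
      0x1816720a0b5888c050ad262d5a40; 0x18168a282d62230142b498b5690;
      0x1816ab0a0b5888c050ad262d5a40; 0x1816694905ac0ed2100a9331a17e;
      0x1816695505ac446028569316ad20; 0x18165e120b581da42015266342fc;
      0x18165e0a0b5888c050ad262d5a40; 0x18165e4416b01b48402a4cc685f8;
      0x18165d4a0b5888c050ad262d5a40; 0x181659020b581da42015266342fc;
      0x1816596005ac02e2740a9332ad7e; 0x181658820b580da42015266342fc;
      0x1932c89e67bb0080182608168510; 0x18165a4416b03b48402a4cc685f8;
      0x18165a820b5805c4e81526655afc; 0x1816588c0b5805c4e81526655afc;
      0x1816591402181da4201446633e1c; 0x18165880021805c4e81446653e1c;
      0x181658c802180ec4e81446653e1c; 0x1932c81005080ed2100a23318028;
      0x18165bebbe6b314a72b8145bac00; 0x181659440b581da42015266342fc;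
      0x18165943011840a360570c22c852; 0x1932c81e85200b89d02a48ca7c38;
      0x1932cd0a58d00460342e08118508; 0x19b2c9157e1885c4e814462b6358;
      0x181658ca04204782740a2d15ad04; 0x1a1659abfc3c8f04e8145a2b5a08;
      0x1932cd085a5208c0b85c201749fc; 0x1932cd08665208c0b85c201749fc;
      0x1a1659af50184782740a2315b1ac; 0x1932c9b258488f04e815262b57fc;
      0x1a16596b56508d803020ea2d5a40; 0x1a1659af4b948f04e8145a2b5a08;
      0x1a1659af05308f04e814462b6358; 0x181658cb55284782740a9215abfe;
      0x18165bc9361085c4e8145a2b6358; 0x1932c854e9348ac6c0acec455afc;
      0x1932cd0e095b04605c2e100ba4fe; 0x1816594b41509d803020ea2d5a40;
      0x1a165969102c46c018102b16adde; 0x18165bc8125085c4e815242b57fc;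
      0x1932c8520ab1158d8158b48b2000; 0x1932c87419309d803022ea2d5a40;
      0x1932c9b197748f04e8145a2b5a08; 0x1932c874c4093b006040ac5a1440;
      0x1a1659693cb11b0060441c5ab778; 0x1932cd0b10d84676312cabb536a;
      0x1932c877dc2e4ec018102b16adde; 0x18165bca940a42e2740a2d15ad04;
      0x1932cd0ab25b04605c2e080ba5ac; 0x1932c9b194708f04e814462b6358;
      0x1a1659abb7408f04e815242b57fc; 0x1932cd0ab04104605c2e080ba5ac;
      0x1932c877ded13b006045d45ab480; 0x181658c850048f04e8145a2b5a08;
      0x1932c877a8249d8030220e2d5b48; 0x1a1659abb4291e09d02a4856aff8;
      0x1932c9b193948f04e814462b63f0; 0x1a165af35c508146c0ae064590a4;
      0x1932c877a8013b0060441c5ab690; 0x18165bca908085c4e815242b57fc;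
      0x1932c9b35ae48f04e815262b57fc; 0x1932c9b190e88f04e814462b63f0;
      0x1932c9b190c11e09d0288c56c6b0; 0x1932c9b190311e09d0288c56c6b0;
      0x1932c877db2f14da162fcb2a91a; 0x1932cd0ab2990b2def5dc32ad7e; 0x19b2cf1cf6282dae7c99983c4610;
      0x1a1659a016a00782740a23328508; 0x1932cd11204885e31da0ca174850;
      0x1932c807f954056428566716ad28; 0x1a1659a016a30146c194ca450a10;
      0x19b2c93edc75945d0369c26a0050; 0x1932c80e853e85c850d8ae2d5a50;
      0x19b2c93edb52d08010561309a5ac; 0x19b2c9356ec29480105a63318508;
      0x1932cd1007bd35c0b99aea174610; 0x1932cd1fed654945e08cf6655afc;
      0x19b2cf1cf63f802018c64716ad04; 0x19b2c93edc603800340a23119f0e;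
      0x19b2c9356ec2c545e88cca650a10; 0x1932cd1fe8070540105a2d16b1ac;
      0x1932cd1fe81d2a90a1b0145ac6b0; 0x1a1659617adce840d18c2e174b58;
      0x1a1659a016b5296d500bb42b5a08; 0x1932cd1fe807454020b45a2d6358;
      0x19b2c9344de2690020acec633e1c; 0x1932cd1fe81c308850d80a2d6358;
      0x19b2cf1cf207950040b4ec2d5a50; 0x19b2cf1afe7ce14051d88a2d63f0;
      0x19b2cf1afe7cda006329945ac7e0; 0x1932cd14cd6e080041684c2693f8;
      0x19b2cf1cf63da98051d88a2d5a08; 0x1932cd14cd7e5a00518c2e1349fc;
      0x19b2c93edb532c05e88c2e174b58; 0x19b2c93edc630a4028b446233e1c;
      0x19b2c9344de2700020acec633e1c; 0x1932c804cd6a1a54e84e18664bf0;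
      0x18165bc3b8cbb68bd11998cab5f8; 0x1932cd1fed7f7500a3b15c5ab4a0;
      0x19b2c9344de06c002014ec633e1c; 0x19b2c93edb5e19549cc61711a9a4;
      0x1932cd1fe8185aef3ab7c422ad28; 0x1932cd112052707b808cca453e1c;
      0x1a1659dfed77a7008c2e13042d7e; 0x1932cd1120527141848e2b119f20;
      0x1a1659dfed77a745685c26085afc; 0x1932c807f9f312c2f85a23328508;
      0x19b2c911b8dedac1698c8e08c0e4; 0x1932c8430cbcd5f5715e0a650a10;
      0x1932c802d7e9f152a8ec3b16eb56; 0x19b2c81535e191f5491c5666531c;
      0x19b2c81535ead912c0ec20473e1c; 0x19b2cf1cf2037136a91c56575214;
      0x1932c804cd71143450ae1823c030; 0x1932c80e8537a8c11aa8180285fc;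
      0x19b2c81535e8ea1680d80a470a10; 0x19b2c81535ead95250ec202d0a70;
      0x19b2c93edb4e6bbc89142e174b58; 0x19b2cf1cf2037124a91c56762808;
      0x1932c8430cb125dc2014ec453e1c; 0x19b2c93edb4e6f84e8cc171da5ac;
      0x19b2c93edb5e18c8a3584c46a690; 0x19b2c93edb4e6b2bd2285c6c06b0;
      0x19b2c911b8deeabb20d88a65c0e4; 0x19b2c911b8dedac5bf3ce42bc6ec;
      0x19b2c81535ead90621d8408e7c38; 0x19b2c911b8ded900e69c3011a148;
      0x19b2c93edb4e6b3429142e174b58; 0x1932cd1fed610b02b4569f0c0870;
      0x1932c8430cb124a5a8145a650a10; 0x1932cd1fe8185b2dd2f76132ad28;
      0x1932cd1fe8185b2dd4176132ad28; 0x1932cd1fe8185b8ba30e1a630b58;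
      0x1a165affa527339a0699a62b6358; 0x1a1659a010d66ad62aa14d238030;
      0x1932c802d7f8ead080d42d328508; 0x1932c802d7f8eba4cc541266531c;
      0x1932c804cd75345a8ca23b15abfe; 0x1a1659a016b52a668b41d856c4c0;
      0x1932c804cd75345a8da02e2b57fc; 0x1a1659a010d66ad624ccd4470050;
      0x1a165affa527339983a46c650040; 0x1932c804cd75345ef3602e0557fc;
      0x1a165affa52927fe732a18450a10; 0x1932c804cd7115eee808767602fc;
      0x1a1659a016b69d85f8abb4470018; 0x1a1659a016b52a668dc76856b410;
      0x19b2c91edbb857dfa84915a6a428; 0x19b2c91edbb857df90d046d35214;
      0x1a165affa527339980c1a6655348; 0x1a1659dfed77a7a4e5e8ca0563f0;
      0x1932cd1fe8185b2def4388655a50; 0x1932c807f956dbd9c1a29a2b6260;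
      0x1a165affa527339aa5a0c62b0a20; 0x19b2c91edbb857df91508da6a428;
      0x1932cd112052719cfc2d2c7890c0; 0x1a165affa52733998181e8ca0080;
      0x1a1659a010c1e7454ec076655afc; 0x1932c999229eecb4ec283502ada4;
      0x1932cd1fe8184705d9c552239f0e; 0x1932cd1fe8184705d9cb50473e1c;
      0x1a1659a010c1e6b460034e455afc; 0x1a1659a010c1e6b460080f22ad7e;
      0x1a1659d308bbe6add7604b3b4020; 0x1a1659a010c1e6b460188e455a50;
      0x1a1659a010c1e6b4601d5722ad28; 0x1a1659a010c1e6b4601e5c8ab4a0;
      0x1932c85cf57de40b6c3806085afc; 0x1932cd1fe8184705d9dec5d9fc6;
      0x1a1659a010c1e6b4601cd4455a50; 0x1a1659a010c1e6b4601886455a50;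
      0x1932cd1fe8184705d9c258473e1c; 0x1932cd1fe8184705d9c6b0473e1c;
      0x1a1659a010c1e6b4601656455a50; 0x1a1659a010c1e6b46017ec8ab5f8;
      0x1932c8460dff35ecf38bc0ec06b0; 0x1a1659a010c1e6b4601788455afc;
      0x1a1659a010c1e6b46000e2455afc; 0x1a1659d308bbe6add762e0768040;
      0x1a1659a010c1e6b46017a0455afc; 0x1a1659a010c1e6b46016f2455a50;
      0x1932cd1fe8184705d9d60bb534a; 0x1a1659a010c1e6b46008a88ab5f8;
      0x1a1659a010c1e6b46000c08ab5f8; 0x1a1659a010c1e6b46019ce2acbc;
      0x1a165affa5292146b0b3a03b6358; 0x1a1659a016b69c4b667372131d94;
      0x1932c807f956dbf48cac87519dba; 0x1a1659a016b69c4b666365a85368;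
      0x1a165affa52921addf93522a5348; 0x1932c807f956dbf48cac8e0b29ba;
      0x1932c807f956dbf48cb0de45a9b4; 0x19b2c81535ead8b48ea9583b6358;
      0x19b2c81535ead8b48eb45356a308; 0x1a1659a016b69c4b66737c047650;
      0x19b2c81535ead8b48ea9514b6358; 0x1932c807f956dbf48cac81ac2dbc;
      0x1932c807f956dbf48cac81295374; 0x19b2c81535ead8b48eb45f005a28;
      0x1a165affa52921addf9356295348; 0x1932c807f956dbf48cac8c223b74;
      0x1932c807f956dbf48cb0d9293b68; 0x1932c807f956dbf48cac8bf0a6e8;
      0x1932c807f956dbf48cac8a1276e8; 0x19b2c81535ead8b48eb45a245a28;
      0x1932c807f956dbf48cb0d2ab0060; 0x1932c807f956dbf48cac8bca5374;
      0x1932c807f956dbf48cac87800050; 0x1932c807f956dbf48cb0d2ba0060;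
      0x1932c807f956dbf48cac8a2e1778; 0x19b2c81535ead8b48eb45edab410;
      0x1932c807f956dbf48cb0d2bc00c0; 0x1a165affa52921addf9359d406b0;
      0x1932c807f9430bc5d8a2b4952480; 0x1932c807f95312cbb5485d44017e;
      0x1932c807f95312cbb5485d447834; 0x1932c807f95312cbb5485d406440;
      0x1932c8430cb26f1aef43b86510e4; 0x1932c8430cb26f1aef43b866d376;
      0x1932c807f95312cbb5485d44a1fc; 0x1932c8430cb26f1aef43b86029cc;
      0x1932c8430cb26f1aef43b867b7a0; 0x1932c8430cb26f1ad8fe88638134;
      0x1932c807f95312cbb5485d4001ec; 0x1932c807f9430bc5d8a2b4bc9040;
      0x1932c8430cb26f1ad8fe886100b4; 0x1932c8430cb26f1aef43b8629aa2;
      0x1932c8430cb26f1aef43b86034c8; 0x1932c8430cb26f1aef43b8611024;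
      0x1932c8430cb26f1aef43b865a80c; 0x1932c8430cb26f1ad8fe89d51b68;
      0x1932c8430cb26f1ad8fe89d79534; 0x1932c8430cb26f1aef43b8612128;
      0x1932c8430cb26f1ad8fe8865e148; 0x1932c8430cb26f1ad8fe89d3b220;
      0x1932c807f9430bc5d8b8532c64a; 0x1932c807f9430bc5d8a2b4bbbbd2;
      0x1932c807f95312cbb5485d41f012; 0x1932c807f9430bc5d8a2b4bbbc5e;
      0x1932c807f9430bc5d8a2b4bbbaa8; 0x1932c807f95312cbb5485d41f024;
      0x181658c3f4f13d26e587b6315ad6; 0x1932c807f9430bc5d8a2b4bbbb28;
      0x1932c807f95312cbb5485d41f6a4; 0x1932c807f9430bc5d8a2b4bbbeb4;
      0x1932c807f9430bc5d8a2b4bbbed8; 0x1932c807f95312cbb5485d41f394;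
      0x1932c807f95312cbb5485d41f1b8; 0x1932c807f95312cbb5485d41f1d8;
      0x1932cd1e801046abb0b61d4563a8; 0x1932c807f9430bc5d8a2b4bbbfc0;
      0x1932c807f9430bc5d8a2b4bd2dd8; 0x1932c807f9430bc5d8a2b4bd2960;
      0x1932c807f9430bc5d8a2b4bd2e68; 0x1932c8417ad3c3d88cac815d6d4; 0x181658c3f4f07061859a5699042]%hex.

Definition marks3 : seq Hexadecimal.uint :=
  [:: 0x005164282d6200800a16a4c5ab480; 0x005a69482d6016b004119ecc685f8;
      0x0419640000600034840288cc600a0; 0x1802458905ac0ad2008233d98d0bf;
      0x18532c78001815a40104665318028; 0x18a054c105ac0006908054998d0bf;
      0x18934d940218000d2100a23319f0e; 0x19a52c8515a455d61b0233d9156bf;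
      0x189a69600018400600c08ba8b5690; 0x18ba6960006016b00411994c600a0;
      0x18b52c84000c0006908051198c014; 0x184a64282d62aeb0d8119ec8ab5f8;
      0x18428c8505ac55d61b0233d9156bf; 0x186164282d62aeb0d8119ec8ab5f8;
      0x18414c8505ac55d61b0233d9156bf; 0x181864282d62aeb0d8119ec8ab5f8;
      0x181a0c8505ac55d61b0233d9156bf; 0x1814a4282d62aeb0d8119ec8ab5f8;
      0x181c848505ac55d61b0233d9156bf; 0x1822a4282d62aeb0d8119ec8ab5f8;
      0x182ac08505ac55d61b0233d9156bf; 0x181a69282d62aeb0d8119ec8ab5f8;
      0x181a540505ac55d61b0233d9156bf; 0x181729282d62aeb0d8119ec8ab5f8;
      0x18170a0505ac55d61b0233d9156bf; 0x181784282d62aeb0d8119ec8ab5f8;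
      0x1817052505ac55d61b0233d9156bf; 0x181661282d62aeb0d8119ec8ab5f8;
      0x1816682505ac55d61b0233d9156bf; 0x181652282d62aeb0d8119ec8ab5f8;
      0x1816720a0b58abac360467b22ad7e; 0x18168a282d62aeb0d8119ec8ab5f8;
      0x1816ab0a0b58abac360467b22ad7e; 0x1816694905ac0006908054998d0bf;
      0x1816695505ac55d61b0233d9156bf; 0x18165e120b58000d2100a9331a17e;
      0x18165e0a0b58abac360467b22ad7e; 0x18165e4416b0001a42015266342fc;
      0x18165d4a0b58abac360467b22ad7e; 0x181659020b58000d2100a9331a17e;
      0x1816596005ac02d6008233d98d0bf; 0x181658820b58000d2100a9331a17e;
      0x18165aafd017809001a130488c284; 0x18165a4416b0001a42015266342fc;
      0x18165a820b5805ac010467b31a17e; 0x1816588c0b5805ac010467b31a17e;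
      0x181659140218000d2100a23319f0e; 0x18165880021805ac0104665319f0e;
      0x181658c8021815a40104665319f0e; 0x1932c81005080006908051198c014;
      0x1932cd27a530280005c10750ba4fe; 0x181659440b58000d2100a9331a17e;
      0x1932c98d530802d600a233288cf87; 0x1932c9ab14a0001803020ea2d0a70;
      0x1932c9b3f670000600a760288c284; 0x19b2cf197e1a010c0106d3509a5ac;
      0x181658ca0420400600c08158b4288; 0x1a1659aa11c0800c018102b168510;
      0x181658ce9830800c018117516ad20; 0x1a165af0d40087ac028470716ada4;
      0x1a1659ab5128400600c083a8b5690; 0x1a16596b3848800c018110716adde;
      0x18165bca161085ac010466516b1ac; 0x1932cd0c181a2bad0282e0909a308;
      0x1932c993d000800c018110716ada4; 0x1932c8534024400600c08838b56ef;
      0x1932c8525810800c018110716ada4; 0x1932c9b29800800c018110716ada4;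
      0x1a1659aae80a400600c08838b56ef; 0x1932c8526110800c018110716ada4;
      0x1a165af4cd0243d601423158b4288; 0x1a165af7e30087ac028470716ada4;
      0x1932c871ba31001803022ea2d5a40; 0x1932c997d434800c018107516ad20;
      0x1932cd0b7b022bad0282e1009a4fe; 0x1932c991ac31001803022ea2d5a40;
      0x1932c8525ab1001803020562d5bbc; 0x181658cedfb0356aa23b12bc4006;
      0x1a165af15bd243d601423158b56ef; 0x1932cd0ea2b315d6814170404d2fc;
      0x1932cd08545915d6814170804d27f; 0x181658c82528800c018102b16adde;
      0x1a165af1584487ac028462b16adde; 0x1a165af1585443d601423ba8b5690;
      0x1932cd0e24b4575a0505c12134b58; 0x1932c997dd54800c018117516ad20;
      0x1932c877a824800c018110716ada4; 0x1932cd0e2304575a0505c261349fc;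
      0x1816594a94d4800c018107516ad20; 0x1932cd0ca3122bad0282e0909a308;
      0x1932c877a8010018030220e2d5b48; 0x1932c9b29628800c018110716ada4;
      0x1932cd0ca3162bad0282e0909a308; 0x1932c9b29654800c018110716adde;
      0x1932c997ddc9001803022ea2d5a40; 0x1932c8756f810018030220e2d5bbc;
      0x18165bce6cc54dd5a3baf43c6b5d; 0x1932cd0ca451854ccf6822db3e7b;
      0x1932cd0314a5e9490a58f1431800c; 0x1a1659de41880ad20082d3198c2d6;
      0x1932cd16dd68affea4a586709a428; 0x1932c80e8530000600c09118b58fc;
      0x1a1659de41880020034270c11c852; 0x19b2c816dee99670e85d4e334800c;
      0x1a165afb7ac0dc1a05016182d0a20; 0x19b2cf1d33c555120082d318b5682;
      0x1816594330881a1d0200a67318028; 0x1a165964852cb1a82f446170ba4fe;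
      0x19b2cf1d33df0b184286c4516ad04; 0x19b2cf14021c820002e66bb05d2fc;
      0x1932cd0314b99c24018ca75319f0e; 0x19b2cf1d33c50b08274106515ad04;
      0x1816594316a801830200a633185fc; 0x1932c869f21381a40105a1309a5ac;
      0x1932c86cc813ea0901476028b75ab; 0x1816594316a898a401056633185fc;
      0x1932c869f20034a82f04675329f0e; 0x1816594316b80944014762298c284;
      0x1932c86cc80330990280a2d16e376; 0x1a1659dec806c94d1782386996429;
      0x1a1659d30cbe00190288a1709a5ac; 0x1a165964801f60400518ccc134850;
      0x19b2cf129b4e90b82f446170ba5ac; 0x1816594316b83de446c5a633b4812;
      0x1a165964853c05508d8b4267602fc; 0x1a1659d7fc7cca240b99a9a174860;
      0x1816594316a9cf702748a6532800c; 0x1a1659de419f4e6b00c63238b58d6;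
      0x181659433098b454214362298cf87; 0x1932c869f203048001a054908cf87;
      0x1a1659de419f4ce84286c4516b1ac; 0x1932cd1007bdd962028c66509a308;
      0x1932cd1007bdd815014633284d184; 0x181659433098b6d4850d88a633e1c;
      0x181659433098b74a018c647319f0e; 0x1932c86cc813d500010566309a428;
      0x1932c869f20307680681524233e1c; 0x181659433098b716018c647319f0e;
      0x1816594316b88188028c66531800c; 0x1932c86cc813d664051d80a2dd6ac;
      0x18165bc31adab7b4018ca2b31e800; 0x1932c86cc813d648028ec0516eb56;
      0x1932c86cc813d5a8028ec0516eb56; 0x1932c86cc813d5a4020acc6134850;
      0x1932c86cc813d614051d80a2dd6ac; 0x1a1659de419f4f91347648a2b6358;
      0x181659433098b7204685a672ba93c; 0x1a1659a113036e3608205491994dd;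
      0x1932c80fe53a79a54802b8618c2d6; 0x19b2c918029ffe38500ec4523800c;
      0x19b2c918029ff40b5324532815682; 0x19b2c816dee8f90e96a170411c284;
      0x19b2cf129b4089c08f45a92239f0e; 0x1a1659d30ca8c89601436028b4288;
      0x19b2c91132814b52abcd623168510; 0x1a1659a1130a7b1404426103329ba;
      0x19b2c918029ff405210362291c006; 0x1a165afb7ade09001185a7a328020;
      0x19b2cf140212f6b2824466b040508; 0x19b2c918029ffe3e964ec4523800c;
      0x19b2cf1402008b51a285a2d168510; 0x19b2cf1402008b55a33b24d5275ab;
      0x19b2cf140212f6b60a4466b040508; 0x19b2c918029ffe30ca46c4502ad04;
      0x19b2cf1402008b51b105a2d238508; 0x1932c86edfbff6f1c585a6732ad14;
      0x19b2c918029ffe3c864ec4502ad04; 0x1932c9bad66e24ec12076228d80fc;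
      0x1a1659a113020af5b208cea473e1c; 0x19b2c816dee8f90f6885c1066531c;
      0x1a1659d7fc694b3d2887608358538; 0x1a165afb7ade22dd39e93c502abfe;
      0x19b2cf140212f6b1a508cd6450a10; 0x19b2cf140212f6b2c308cd6080a10;
      0x19b2c9113293d4d6324d623228508; 0x1a1659b06fd003da9122c37a8000c;
      0x19b2c81bfe730789cc0684709a5f8; 0x181659433084b1250c2a8a58b4298;
      0x19b2c81525bb429c2535d8611c284; 0x1a1659a11314921d664307602ad28;
      0x1a1659a1131493dae65b27602ad28; 0x19b2c91132814b20332a5a2916400;
      0x1a16596485380359eea558611f00c; 0x19b2c918029ffe3ac462a08168510;
      0x1a165afb7ac82447d0984860b4288; 0x1a1659a1131493d82e4142e470358;
      0x181659433085db310d8894d168530; 0x1a165afb7ac8244130e95a232e800;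
      0x181659433084b1250de054b168530; 0x181659433084b1251b73107040030;
      0x1a165afb7ac8994833d650c228508; 0x19b2c91132814b203224b4522c800;
      0x1a1659a1131493dae77963602ad28; 0x1a1659a1131493d93766876056358;
      0x1932c806dbda7a56a62a046450a10; 0x19b2c91132814b2033e034522c800;
      0x1a1659a1131493d82e16636238028; 0x181658c316ac3566a6b606602eb00;
      0x1a1659a1131493d936c4a1702b1ac; 0x1a16596485380359ef6f30d23e800;
      0x1a1659a1131493dae76929302b1ac; 0x181659433085db31f795a06050a60;
      0x1a1659a11314921e25fa82e2b6358; 0x1932c80e8536b7aa5d6d4ee2d5a50;
      0x1932c9bad080d10318f8045168530; 0x1a1659b06fd003ded09e4b085d2fc;
      0x1932c86edfbff6f1142d2a90b56ef; 0x1a165964853802594d65115318028;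
      0x1932c9bad080d10d6e5a22a02eb56; 0x1932c9bad080d10d6e5a952814298;
      0x1932c9bad080d10d6e5a0ba0175ab; 0x19b2c918028092190d9c09516eb56;
      0x1932c9bad080d10d6e5a0a8814298; 0x1932c9bad080d10d6e5a20a050a60;
      0x1a1659b06fd003ded09e8250ba5ac; 0x1a165964853802594d6568e74beb0;
      0x1a1659605fdbfd23a3e1129228028; 0x1932c9bad080d10d6e5ab0602eb56;
      0x1932c9bad080d10d6e5a314028530; 0x19b2c918028092190d9c18516eb56;
      0x1932c86edfbff6f1142d0c816ada4; 0x1932c86edfbff6f1142d0cc2d5b48;
      0x1932c9bad080d10d6e5a31c05d6ac; 0x1932c9bad080d10d6e5a329028530;
      0x1a165964853802594d652ab318028; 0x1932c86edfbff6f1142d13516adde;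
      0x1932c9bad080d10d6e5a325028530; 0x1932c9bad080d10d6e5a640028530;
      0x1a165964853802594d65a2b1ffe3; 0x1a165964853802594d651ec6342fc;
      0x1932c9bad080d10d6e5a32805d6ac; 0x1a1659d30ca8c89fd9d2a5eeb24e;
      0x1932c80fe53a79aecb766381db1ac; 0x181659433084b121262d16ca914da;
      0x1a1659d30ca8c89fd12c0f04352d6; 0x181659433084b121262d169609db4;
      0x1a1659d30ca8c89fd1987c62aa428; 0x181659433084b121262d16ca94eda;
      0x181659433084b121262d16ce814da; 0x181659433084b121262dda84a8028;
      0x1a1659d30ca8c89fd12c0f22052d6; 0x1932c9bad080d10d5b4e318000b58;
      0x181659433084b121262dda9b429ba; 0x181659433085db31086535aca14da;
      0x181659433084b121262d16c949db4; 0x1932c9bad080d10d5b4e31fcd05ac;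
      0x1a165afb7ac89943b02d69f8e0020; 0x1a165afb7ac89943b02d699088020;
      0x181659433084b121262d16b121db4; 0x1932c9bad080d10d5b4e31c262748;
      0x181659433084b121262ddacc65374; 0x181659433084b121262ddac189dba;
      0x1932c9bad080d10d5b4e31c3513a4; 0x1a165afb7ac89943b02d69f8a8020;
      0x1a165afb7ac89943b02d69fbd0020; 0x1a1659d30ca8c89fd12c0f5b2a9a4;
      0x181659433084b121262d168b15db4; 0x181659433084b121262d16cd85368;
      0x1a165afb7ac89943b02d69a4d49fc; 0x181659433084b121262ddac1c0a70;
      0x181659433085db31086535f1c0940; 0x181659433085db31086535ae8017f;
      0x181659433085db3108653598d738e; 0x181659433085db31086535aeb4120;
      0x181659433085db31086535aeb43ec; 0x181659433085db31086535f120101;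
      0x181659433085db31086535f1210fe; 0x181659433085db3108653598fc5fe;
      0x181659433085db3108653598ece7a; 0x181659433085db3108653598ee802;
      0x181658c62b80a7f0d50eb524dd580; 0x1a165afb7ade22d2fd6d69b4f56a4;
      0x181659433085db3108653598c83fe; 0x181659433085db31086535aeaf34f;
      0x1a165afb7ade22d2fd6d69b4f30e4; 0x1a165afb7ade22d2fd6d69b4e4412;
      0x181659433085db3108653598d02fe; 0x1a165afb7ade22d2fd6d69b4e8d48;
      0x1a165afb7ade22d2fd6d69b4e80a4; 0x181659433085db31086535aea52fa;
      0x181659433085db31086535aea6140; 0x181659433085db31086535f1348ec;
      0x181659433084b1251885da87a5f6; 0x181659433085db31086535f114e83;
      0x181659433085db31086535f114e57; 0x181659433085db31086535f114e57;
      0x181659433085db31086535ae9dd54; 0x181659433085db31086535ae9dfae;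
      0x181659433085db31086535ae9dd55; 0x181659433085db31086535ae89190;
      0x181659433085db31086535ae9dc06; 0x181659433085db31086535ae9df5a;
      0x1a165afb7ade22d2fd6d69b4cb7a4; 0x181659433085db31086535ae9dc22;
      0x1a165af85fce78fef3efd53cfd62c; 0x181659433085db31086535ae9dc14;
      0x19b2c91bb09f039032ca638f315ea; 0x181659433085db31086535ae9dfe0;
      0x1932c806dbd4fb1776ba2d61168aa; 0x181659433085db31086535f114d20;
      0x181659433085db31086535ae89074; 0x19b2c918029ffe3ac705b64c7eea;
      0x181659433084b1251885e184fd23]%hex.
Definition four0 : Hexadecimal.uint := 0x198849a45209a4520998522460912168466184918a48616682192411898598466824618242485a246109899845a1825884607618646a05086662485a246139891%hex.

Definition four1 : Hexadecimal.uint := 0x19a109205a49205a49818649252194948646209248256894a924261092906589886182624584a464611684a942192198119648628494c98162142984986189160296c8460%hex.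

Definition four2 : Hexadecimal.uint := 0x198849a45209a452099852246091294825244a29261241865921859a08649046261694849a19090986229468411869984191a2492632524919026986112628149a19844624a14930%hex.

Definition four3 : Hexadecimal.uint := 0x198849a45209a45209990624618129428658462216251862061858a0584866859092904a50a5a121690912928518a24618648991206609a649c41849a405a1189265121294862618a15092d8%hex.

(** One literal for each edge of the graph with two copies of [double_block], in the order in which
    the edges are started; the literal at position [e] colours the graph with the ends of edge [e]
    deleted. *)
Definition marks j := match j with 0 => marks0 | 1 => marks1 | 2 => marks2 | _ => marks3 end.
Definition four j := match j with 0 => four0 | 1 => four1 | 2 => four2 | _ => four3 end.

(** * Verification of the concrete words *)

Fixpoint iterate_trie n y t := if n is n.+1 then iterate_trie n y (trie_merge t (trie_run y t)) else t.

(** Four rounds make the accumulated profiles invariant under a further [double_block];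
    [expansion_ok] confirms this. The trie does not depend on [j], which affects only the closing
    word. *)
Definition chain_trie := iterate_trie 4 double_block (trie_run start start_trie).

(** One application of [double_block] already yields every reachable state, as [frontier_block]
    confirms. *)
Definition frontier_runs :=
  let F := undup (runs distinct3 start [::]) in
  undup (F ++ flatten (map (runs distinct3 double_block) F)).

Definition param_sums :=
  undup (flatten [seq undup [seq map ksum (reshape [:: 3; 3] o) | o <- runs distinct3 param_rest f]
                 | f <- frontier_runs]).

(** As [sum_runs] does not look inside poles, the computation goes through with variable words [e0],
    [e2], [e5] and serves all four families. *)
Lemma sums_ok e0 e2 e5 : sum_runs (pieces e0 e2 e5) [:: 3; 3] param_sums = [::].
Proof. by vm_cast_no_check (erefl ([::] : seq (seq (bool * bool)))). Qed.

(** An enumeration of all colourings of the pole from each of the 27 input triples; no property of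
    the snark itself is invoked. *)
Lemma superedge_pole : superedge pole.
Proof. by vm_cast_no_check (erefl true). Qed.

Lemma superedge_star_pole : superedge star_pole.
Proof. by vm_cast_no_check (erefl true). Qed.

Lemma start_arity : arity start 0 = Some 6.
Proof. by []. Qed.

Lemma double_block_arity : arity double_block 6 = Some 6.
Proof. by []. Qed.

Lemma closing_arity j : j < 4 -> arity (closing j) 6 = Some 0.
Proof. by case: j => [|[|[|[|j]]]] //; vm_compute. Qed.

(** 14 vertices of [param_rest], seven further poles of 18, and the nine vertices of the Petersen
    graph other than h0. A double-star pole has 28 vertices in place of 18, whence [10 * j]. *)
Lemma nverts_body j : j < 4 -> nverts (body j) = 149 + 10 * j.
Proof. by case: j => [|[|[|[|j]]]] //; vm_compute. Qed.

Lemma pieces_wf j : j < 4 -> macros_wf (variant_pieces j) [:: 3; 3].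
Proof. by case: j => [|[|[|[|j]]]] //; vm_compute. Qed.

Lemma variant_superedges j : superedges (variant_pieces j).
Proof.
have sp (b : bool) : superedge (if b then star_pole else pole).
  by case: b; [exact: superedge_star_pole | exact: superedge_pole].
exact: (conj (sp _) (conj (sp _) (conj superedge_pole (conj superedge_pole
         (conj superedge_pole (conj (sp _) I)))))).
Qed.

Lemma frontier_start : all (fun f => f \in frontier_runs) (runs distinct3 start [::]).
Proof. by vm_cast_no_check (erefl true). Qed.

Lemma frontier_block :
  all (fun f => all (fun g => g \in frontier_runs) (runs distinct3 double_block f)) frontier_runs.
Proof. by vm_cast_no_check (erefl true). Qed.

Lemma frontier_colours :
  all (fun f => (arity param_rest (size f) == Some 6) && all (fun c => c < 3) f) frontier_runs.
Proof. by vm_cast_no_check (erefl true). Qed.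

Lemma frontier_sums :
  all (fun f => all (fun o => map ksum (reshape [:: 3; 3] o) \in param_sums)
                    (runs distinct3 param_rest f)) frontier_runs.
Proof. by vm_cast_no_check (erefl true). Qed.

Lemma body_uncolourable j k cs : j < 4 -> all (fun c => c < 3) cs ->
    size cs = nids (start ++ repeat k double_block ++ body j) ->
  exec distinct3 (start ++ repeat k double_block ++ body j) [::] cs = None.
Proof.
move=> j4; apply: (chain_uncolourable frontier_start frontier_block frontier_colours frontier_sums).
- exact: pieces_wf.
- exact: variant_superedges.
exact: sums_ok.
Qed.

Lemma expansion_ok : all (fun j => expansion_check start double_block (closing j) chain_trie) (iota 0 4).
Proof. by vm_cast_no_check (erefl true). Qed.

Lemma marks_valid : all (fun j => marks_ok start double_block (closing j) (marks j)) (iota 0 4).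
Proof. by vm_cast_no_check (erefl true). Qed.

Lemma four_valid : all (fun j => four_check start double_block (closing j) (four j)) (iota 0 4).
Proof. by vm_cast_no_check (erefl true). Qed.

Lemma start_nverts : nverts start = 4.
Proof. by []. Qed.

Lemma double_block_nverts : nverts double_block = 8.
Proof. by []. Qed.

Lemma apex_nverts : nverts apex = 3.
Proof. by []. Qed.

Lemma variant_graph j k : j < 4 -> 1 < k ->
  exists G : sgraph,
    [/\ #|G| = 156 + 10 * j + 8 * k, snark G, strictly_critical G & cyclically_connected G 6].
Proof.
move=> j4 k2; have j4' : j \in iota 0 4 by rewrite mem_iota.
have := chain_graph start_arity double_block_arity (closing_arity j4) isT
  (allP expansion_ok j j4') (fun cs => @body_uncolourable j k cs j4)
  (allP marks_valid j j4') (allP four_valid j j4') k2 isT isT.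
case=> G [cG sG scG ccG]; exists G; split=> //.
rewrite cG (nverts_cat start) (nverts_cat (repeat _ _)) (nverts_cat (body j)) nverts_repeat.
rewrite nverts_body // start_nverts double_block_nverts apex_nverts.
by rewrite (mulnC k) addnCA addnC (addnAC 149) addnA.
Qed.

Unset Implicit Arguments.

Theorem theorem6 (n : nat)
  (hn : [\/ n = 0 %[mod 8] /\ 320 <= n,
            n = 2 %[mod 8] /\ 306 <= n,
            n = 4 %[mod 8] /\ 324 <= n
          | n = 6 %[mod 8] /\ 342 <= n]) :
  exists G : sgraph,
    [/\ #|G| = n, snark G, strictly_critical G & cyclically_connected G 6].
Proof.
have main j r : j < 4 -> n = r %[mod 8] -> 156 + 10 * j = r %[mod 8] -> 306 <= n ->
  exists G : sgraph,
    [/\ #|G| = n, snark G, strictly_critical G & cyclically_connected G 6].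
  move=> j4 nr jr n306; pose b := 156 + 10 * j.
  (* The chain needs two copies of [double_block], that is 16 vertices; the largest base order is
     186, and 202 is below 306. *)
  have b186 : b + 16 <= n by apply: leq_trans n306; rewrite -addnA leq_add2l; case: j j4 {jr b} => [|[|[|[|]]]].
  have nb : b <= n by apply: leq_trans b186; rewrite leq_addr.
  have d8 : 8 %| n - b by rewrite -eqn_mod_dvd // nr jr.
  have nE : n = 156 + 10 * j + 8 * ((n - b) %/ 8) by rewrite [8 * _]mulnC divnK // subnKC.
  by rewrite {1}nE; apply: variant_graph => //; rewrite leq_divRL // leq_subRL.
case: hn => -[nr n3].
(* The base orders 156, 166, 176, 186 for [j] = 0, 1, 2, 3 are 4, 6, 0, 2 modulo 8. *)
- by apply: (main 2 0) => //; apply: leq_trans n3.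
- by apply: (main 3 2) => //; apply: leq_trans n3.
- by apply: (main 0 4) => //; apply: leq_trans n3.
- by apply: (main 1 6) => //; apply: leq_trans n3.
Qed.
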